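(* Let $(S,\mathcal{A})$ be a measurable space, $n\geq 3$, and $X_1,\dots,X_n$ i.i.d. random variables in $S$ with distribution $P$; let $P_n=\frac1n\sum_{i=1}^n\delta_{X_i}$. Let $\mathcal{F}$ be a class of measurable functions $S\to[0,1]$ (satisfying the standard measurability conditions of empirical process theory). Let $\varepsilon_1,\dots,\varepsilon_n$ be i.i.d. Rademacher random variables independent of the $X_i$, and $R_n(f)=\frac1n\sum_{i=1}^n\varepsilon_i f(X_i)$. Let $\psi_n:[0,\infty)\to[0,\infty)$ be a (possibly data-dependent, i.e. depending on $X_1,\dots,X_n$) non-decreasing concave function with $\psi_n(0)=0$ such that \[ \mathbb{E}_{\varepsilon}\Big[\sup_{f\in\mathcal{F},\,P_nf\leq r}|R_n(f)|\Big]\leq\psi_n(\sqrt r)\quad\text{for all } r\geq0, \] where $\mathbb{E}_\varepsilon$ denotes expectation with respect to the Rademacher variables only. Let $\hat r_n$ be the largest solution of $r=\psi_n(\sqrt r)$. Then there exists a constant $K>0$ such that for every $t>0$, with probability at least $1-2e^{-t}$, for all $f\in\mathcal{F}$, \[ Pf\leq K\left(P_nf+\hat r_n+\frac{t+\log\log n}{n}\right). \]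
   Context: $Pf=\int f\,dP$ and $P_nf=\frac1n\sum_{i=1}^n f(X_i)$. *)

(* Defs.v *)
From HB Require Import structures.
From mathcomp Require Import all_boot all_order all_algebra.
From mathcomp Require Import all_classical all_reals all_analysis.
Set Implicit Arguments. Unset Strict Implicit. Unset Printing Implicit Defensive.
Import Order.TTheory GRing.Theory Num.Theory numFieldNormedType.Exports.
Local Open Scope classical_set_scope.
Local Open Scope ring_scope.

Definition emp_mean (R : realType) (S : Type) (n : nat) (x : 'I_n -> S)
  (f : S -> R) : R := n%:R^-1 * \sum_(i < n) f (x i).

Definition rad_avg (R : realType) (S : Type) (n : nat) (x : 'I_n -> S)
  (sg : {ffun 'I_n -> bool}) (f : S -> R) : R :=
  n%:R^-1 * \sum_(i < n) (-1) ^+ sg i * f (x i).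

(* E_eps [ sup_{f in F, P_n f <= r} |R_n f| ] : expectation over i.i.d.
   uniform signs only (independent of the sample), i.e. the average over the
   2^n sign vectors; sup of the empty set is 0 (mathcomp's [sup]). *)
Definition loc_rad (R : realType) (S : Type) (n : nat) (F : set (S -> R))
  (x : 'I_n -> S) (r : R) : R :=
  (2 ^+ n)^-1 * \sum_(sg : {ffun 'I_n -> bool})
     sup [set `|rad_avg x sg f| | f in [set f | F f /\ emp_mean x f <= r]].

Definition mutually_independent (d d' : measure_display) (R : realType)
  (S : measurableType d) (Omega : measurableType d')
  (Pr : probability Omega R) (n : nat) (X : 'I_n -> Omega -> S) : Prop :=
  forall B : 'I_n -> set S, (forall i, measurable (B i)) ->
    Pr [set w | forall i, B i (X i w)] = (\prod_(i < n) Pr (X i @^-1` B i))%E.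

Definition has_distribution (d d' : measure_display) (R : realType)
  (S : measurableType d) (Omega : measurableType d')
  (Pr : probability Omega R) (P : probability S R) (Y : Omega -> S) : Prop :=
  forall B : set S, measurable B -> Pr (Y @^-1` B) = P B.

Definition concave_on_nonneg (R : realType) (psi : R -> R) : Prop :=
  forall a b l : R, 0 <= a -> 0 <= b -> 0 <= l <= 1 ->
    l * psi a + (1 - l) * psi b <= psi (l * a + (1 - l) * b).

Definition pointwise_measurable_class (R : realType) (S : Type)
  (F : set (S -> R)) : Prop :=
  exists G : nat -> (S -> R), (forall m, F (G m)) /\
    forall f, F f -> exists u : nat -> nat,
      forall s, (fun m => G (u m) s) @ \oo --> f s.

(* Main.v *)
Require Import Defs.
From HB Require Import structures.
From mathcomp Require Import all_boot all_order all_algebra.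
From mathcomp Require Import zify ring lra.
From mathcomp Require Import all_classical all_reals all_analysis.
From mathcomp Require Import measurable_realfun measurable_fun_approximation.
Set Implicit Arguments. Unset Strict Implicit. Unset Printing Implicit Defensive.
Import Order.TTheory GRing.Theory Num.Theory numFieldNormedType.Exports.
Local Open Scope classical_set_scope.
Local Open Scope ring_scope.

(**
  If [Pf] exceeds the bound at some [f], then at the dyadic scale [sigma] of
  [Pf] both [P_n f] and the Rademacher complexity of [{P_n f <= 4 sigma}] are
  small multiples of [sigma]: the latter because concavity gives
  [psi (sqrt r) <= sqrt (r * rhat)] for [r >= rhat].  The second condition no
  longer mentions [psi] or [rhat], so the event is measurable.

  Chebyshev's inequality on a ghost sample, followed by random swaps of the
  two samples, reduces the probability of this event to a statement about
  uniform points of the discrete cube, the 2n sample points being fixed: the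
  deviation [Z] between the two halves cannot be large while the Rademacher
  complexity [W] of the first half is small.  Both [Z] and [W] are suprema of
  linear functions of the swap vector, hence convex and Lipschitz, and
  [E Z <= 2 E W], so Talagrand's convex distance inequality bounds the
  probability by [C exp (- c n sigma)].  These bounds are summable over the
  scales [sigma = 2^k K t / n].
*)

(** * Talagrand's convex distance inequality on the cube *)

Section Cube.
Variable R : realType.

Definition cavg n (h : {ffun 'I_n -> bool} -> R) : R :=
  (2 ^+ n)^-1 * \sum_s h s.

Definition cprob n (A : {ffun 'I_n -> bool} -> Prop) : R :=
  cavg (fun s => `[< A s >]%:R).

Lemma ge0_cavg n (h : {ffun 'I_n -> bool} -> R) :
  (forall s, 0 <= h s) -> 0 <= cavg h.
Proof.
by move=> h0; rewrite mulr_ge0 ?invr_ge0 ?exprn_ge0// sumr_ge0.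
Qed.

Lemma le_cavg n (h k : {ffun 'I_n -> bool} -> R) :
  (forall s, h s <= k s) -> cavg h <= cavg k.
Proof.
by move=> hk; rewrite ler_wpM2l ?invr_ge0 ?exprn_ge0// ler_sum.
Qed.

Lemma eq_cavg n (h k : {ffun 'I_n -> bool} -> R) : h =1 k -> cavg h = cavg k.
Proof. by move=> hk; congr (_ * _); apply: eq_bigr. Qed.

Lemma cavgD n (h k : {ffun 'I_n -> bool} -> R) :
  cavg (fun s => h s + k s) = cavg h + cavg k.
Proof. by rewrite /cavg big_split mulrDr. Qed.

Lemma cavgZ n (c : R) (h : {ffun 'I_n -> bool} -> R) :
  cavg (fun s => c * h s) = c * cavg h.
Proof. by rewrite /cavg -mulr_sumr mulrCA. Qed.

Lemma cavg_cst n (c : R) : cavg (fun _ : {ffun 'I_n -> bool} => c) = c.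
Proof.
rewrite /cavg sumr_const card_ffun card_bool card_ord -[c *+ _]mulr_natl natrX.
by rewrite mulrA mulVf ?mul1r// expf_neq0// pnatr_eq0.
Qed.

Lemma exchange_cavg n m (h : {ffun 'I_n -> bool} -> {ffun 'I_m -> bool} -> R) :
  cavg (fun s => cavg (h s)) = cavg (fun e => cavg (h ^~ e)).
Proof.
rewrite /cavg -!mulr_sumr mulrCA; congr (_ * (_ * _)); exact: exchange_big.
Qed.

Lemma cavg_inv n (f : {ffun 'I_n -> bool} -> {ffun 'I_n -> bool}) h :
  involutive f -> cavg h = cavg (fun s => h (f s)).
Proof.
by move=> ff; rewrite /cavg (reindex f)//; exists f => s _; exact: ff.
Qed.

Lemma ge0_cprob n (A : {ffun 'I_n -> bool} -> Prop) : 0 <= cprob A.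
Proof. by apply: ge0_cavg => s; rewrite ler0n. Qed.

Lemma le_cprob n (A B : {ffun 'I_n -> bool} -> Prop) :
  (forall s, A s -> B s) -> cprob A <= cprob B.
Proof.
move=> AB; apply: le_cavg => s; rewrite ler_nat.
by case: asboolP => // /AB Bs; rewrite asboolT.
Qed.

Lemma cprobC n (A : {ffun 'I_n -> bool} -> Prop) :
  cprob (fun s => ~ A s) = 1 - cprob A.
Proof.
suff <- : cprob (fun s => ~ A s) + cprob A = 1 by rewrite addrK.
rewrite -cavgD -[RHS](@cavg_cst n); apply: eq_cavg => s.
by rewrite asbool_neg; case: `[< _ >]; rewrite /= ?add0r ?addr0.
Qed.

Lemma cprob_gt0 n (A : {ffun 'I_n -> bool} -> Prop) s : A s -> 0 < cprob A.
Proof.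
move=> As; rewrite mulr_gt0 ?invr_gt0 ?exprn_gt0// (bigD1 s)//= asboolT//.
by rewrite ltr_pwDl// sumr_ge0.
Qed.

Lemma cprob_eq0 n (A : {ffun 'I_n -> bool} -> Prop) :
  ~ (exists s, A s) -> cprob A = 0.
Proof.
move=> nA; rewrite /cprob -[RHS](@cavg_cst n); apply: eq_cavg => s.
by rewrite asboolF// => As; apply: nA; exists s.
Qed.

Lemma cprob_markov n (h : {ffun 'I_n -> bool} -> R) (c : R)
    (A : {ffun 'I_n -> bool} -> Prop) :
  (forall s, 0 <= h s) -> (forall s, A s -> c <= h s) ->
  c * cprob A <= cavg h.
Proof.
move=> h0 Ah; rewrite -cavgZ; apply: le_cavg => s.
by case: asboolP => [/Ah|]; rewrite ?mulr1 ?mulr0.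
Qed.

(** * Splitting off the first coordinate of the cube *)

Definition fcons n (T : Type) (b : T) (y : 'I_n -> T) : 'I_n.+1 -> T :=
  fun i => oapp y b (unlift ord0 i).

Definition ffcons n (b : bool) (s : {ffun 'I_n -> bool}) :
  {ffun 'I_n.+1 -> bool} := [ffun i => fcons b s i].

Lemma fcons0 n (T : Type) (b : T) (y : 'I_n -> T) : fcons b y ord0 = b.
Proof. by rewrite /fcons unlift_none. Qed.

Lemma fconsS n (T : Type) (b : T) (y : 'I_n -> T) i :
  fcons b y (lift ord0 i) = y i.
Proof. by rewrite /fcons liftK. Qed.

Lemma fcons_inj n (T : Type) (f g : 'I_n.+1 -> T) :
  f ord0 = g ord0 -> (forall i, f (lift ord0 i) = g (lift ord0 i)) -> f = g.
Proof.
by move=> fg0 fgS; apply/funext => i; case: (unliftP ord0 i) => [j|] ->.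
Qed.

(** The bit [b] is left free so that an induction on the dimension can put the more probable face
    first. *)
Lemma cavgS n (h : {ffun 'I_n.+1 -> bool} -> R) (b : bool) :
  cavg h = (cavg (fun s => h (ffcons b s)) + cavg (fun s => h (ffcons (~~ b) s))) / 2.
Proof.
rewrite /cavg -mulrDr (reindex (fun p : bool * {ffun 'I_n -> bool} => ffcons p.1 p.2))/=; last first.
  exists (fun s => (s ord0, [ffun i => s (lift ord0 i)])) => [[c s]|s] _ /=.
    congr pair; first by rewrite ffunE fcons0.
    by apply/ffunP => i; rewrite !ffunE fconsS.
  apply/ffunP => i; rewrite ffunE.
  by case: (unliftP ord0 i) => [j|] ->; rewrite ?fconsS ?fcons0 ?ffunE.
rewrite -(pair_big xpredT xpredT (fun c s => h (ffcons c s)))/= big_bool exprS.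
rewrite invfM -[LHS]mulrA [LHS]mulrC.
by case: b => //=; rewrite [in LHS]addrC.
Qed.

(** * Convex sets and squared distances to the vertices *)

Definition vertex n (s : {ffun 'I_n -> bool}) : 'I_n -> R := fun i => (s i)%:R.

Definition mix n (l : R) (x y : 'I_n -> R) : 'I_n -> R :=
  fun i => l * x i + (1 - l) * y i.

Definition sqdist n (x y : 'I_n -> R) : R := \sum_i (x i - y i) ^+ 2.

Definition convex_pred n (C : ('I_n -> R) -> Prop) :=
  forall l x y, 0 <= l <= 1 -> C x -> C y -> C (mix l x y).

Lemma vertex_ffcons n b (s : {ffun 'I_n -> bool}) :
  vertex (ffcons b s) = fcons b%:R (vertex s).
Proof.
apply: fcons_inj => [|i]; rewrite /vertex.
  by rewrite ffunE !fcons0.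
by rewrite ffunE !fconsS.
Qed.

Lemma mix_fcons n l b c (x y : 'I_n -> R) :
  mix l (fcons b x) (fcons c y) = fcons (l * b + (1 - l) * c) (mix l x y).
Proof.
by apply: fcons_inj => [|i]; rewrite /mix ?fcons0 ?fconsS.
Qed.

Lemma sqdist_fcons n b c (x y : 'I_n -> R) :
  sqdist (fcons b x) (fcons c y) = (b - c) ^+ 2 + sqdist x y.
Proof.
rewrite /sqdist big_ord_recl !fcons0; congr (_ + _).
by apply: eq_bigr => i _; rewrite !fconsS.
Qed.

Lemma sqdist_mix n l (z x y : 'I_n -> R) : 0 <= l <= 1 ->
  sqdist z (mix l x y) <= l * sqdist z x + (1 - l) * sqdist z y.
Proof.
move=> /andP[l0 l1]; rewrite /sqdist !mulr_sumr -big_split ler_sum// => i _ /=.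
rewrite -subr_ge0 /mix.
have -> : l * (z i - x i) ^+ 2 + (1 - l) * (z i - y i) ^+ 2 -
  (z i - (l * x i + (1 - l) * y i)) ^+ 2 = l * (1 - l) * (x i - y i) ^+ 2 by ring.
by rewrite mulr_ge0 ?sqr_ge0// mulr_ge0// subr_ge0.
Qed.

(** The tangent to the exponential at the mixture lies below its graph; the claim averages this at
    [u] and [v]. *)
Lemma expR_convex (l u v : R) : 0 <= l <= 1 ->
  expR (l * u + (1 - l) * v) <= l * expR u + (1 - l) * expR v.
Proof.
move=> /andP[l0 l1]; set m := l * u + _.
have tangent w : expR m * (1 + (w - m)) <= expR w.
  have -> : expR w = expR m * expR (w - m) by rewrite -expRD subrKC.
  by rewrite ler_wpM2l ?expR_ge0// expR_ge1Dx.
have -> : expR m = l * (expR m * (1 + (u - m))) + (1 - l) * (expR m * (1 + (v - m))).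
  by rewrite /m; ring.
by rewrite lerD// ler_wpM2l// subr_ge0.
Qed.

(* With [x = 1 - p / q] the choice [l = min 1 (3 x)] reduces the claim to
   [ln y <= y - 1]. *)
Lemma talagrand_weight (p q : R) : 0 < p -> p <= q -> exists2 l, 0 <= l <= 1 &
  expR (l ^+ 2 / 9 + (1 - l) * (ln q - ln p)) <= 2 - p / q.
Proof.
move=> p0 pq; have q0 : 0 < q by exact: lt_le_trans pq.
set x := 1 - p / q.
have r0 : 0 < p / q by rewrite divr_gt0.
have r1 : p / q <= 1 by rewrite ler_pdivrMr// mul1r.
have x0 : 0 <= x by rewrite /x subr_ge0.
have x1 : 0 < 1 - x by rewrite /x; lra.
have -> : 2 - p / q = 1 + x by rewrite /x; ring.
have lnx : x / (1 + x) <= ln (1 + x).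
  have := @le_ln1Dx R (- (x / (1 + x))).
  have -> : 1 - x / (1 + x) = (1 + x)^-1 by field; lra.
  rewrite lnV ?posrE; last lra.
  rewrite lerN2; apply; rewrite ltrN2 ltr_pdivrMr; lra.
have -> : ln q - ln p = ln (1 + x / (1 - x)).
  rewrite -ln_div ?posrE//; congr (ln _); rewrite /x; field.
  by rewrite !gt_eqF// opprB subrKC.
have lnx' : ln (1 + x / (1 - x)) <= x / (1 - x).
  by apply: le_ln1Dx; rewrite (lt_le_trans (ltrN10 R))// divr_ge0// ltW.
suff [l l01 H] : exists2 l, 0 <= l <= 1 &
    l ^+ 2 / 9 + (1 - l) * ln (1 + x / (1 - x)) <= ln (1 + x).
  exists l => //.
  by rewrite -[leRHS]lnK ?posrE ?ler_expR//; lra.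
have [x3|x3] := leP x (1 / 3).
  exists (3 * x); first by apply/andP; split; lra.
  apply: le_trans lnx.
  have l0 : 0 <= 1 - 3 * x by lra.
  apply: (le_trans (lerD (lexx _) (ler_wpM2l l0 lnx'))).
  rewrite -subr_ge0.
  have -> : x / (1 + x) - ((3 * x) ^+ 2 / 9 + (1 - 3 * x) * (x / (1 - x))) =
     x ^+ 3 * (2 + x + 1) / ((1 + x) * (1 - x)) by field; rewrite !gt_eqF//; lra.
  by rewrite divr_ge0 ?mulr_ge0 ?exprn_ge0//; lra.
exists 1; first by rewrite ler01 lexx.
rewrite subrr mul0r addr0 expr1n; apply: le_trans lnx.
by rewrite ler_pdivlMr; lra.
Qed.


(** Induction on [n], cutting the cube into two faces. On the more probable face the points of the
    induction hypothesis are kept; on the other face the points of both faces are mixed with the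
    weight of [talagrand_weight]. A selection [y] of points of [C] stands for the distance to [C],
    so no infimum has to be attained. *)
Lemma talagrand_convex_distance n (C : ('I_n -> R) -> Prop) :
  convex_pred C -> (exists s, C (vertex s)) ->
  exists2 y : {ffun 'I_n -> bool} -> 'I_n -> R, (forall s, C (y s)) &
    cprob (fun s => C (vertex s)) * cavg (fun s => expR (sqdist (vertex s) (y s) / 9)) <= 1.
Proof.
elim: n C => [|n IH] C cC [s0 Cs0].
  have E s : s = s0 by apply/ffunP => -[].
  exists (fun=> vertex s0) => //.
  rewrite (_ : cprob _ = 1); last first.
    rewrite -[RHS](@cavg_cst 0); apply: eq_cavg => s.
    by rewrite (E s) asboolT.
  rewrite mul1r -[leRHS](@cavg_cst 0); apply: le_cavg => s.
  by rewrite /sqdist big_ord0 mul0r expR0.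
pose Cb (b : bool) (y : 'I_n -> R) := C (fcons b%:R y).
have cCb b : convex_pred (Cb b).
  move=> l x y l01 Cx Cy; have := cC l _ _ l01 Cx Cy.
  by rewrite mix_fcons (_ : l * _ + _ = b%:R) //; ring.
pose p b := cprob (fun s => Cb b (vertex s)).
pose P b := p (~~ b) <= p b.
have [b Pb] : exists b, P b.
  by have [H|/ltW H] := leP (p true) (p false); [exists false|exists true].
have pE : cprob (fun s => C (vertex s)) = (p b + p (~~ b)) / 2.
  rewrite /cprob (cavgS _ b); congr ((_ + _) / 2);
  by apply: eq_cavg => s; rewrite vertex_ffcons.
have pgt0 : 0 < p b.
  have : 0 < cprob (fun s => C (vertex s)) by exact: (cprob_gt0 (s := s0)).
  by rewrite pE; move: Pb; rewrite /P; lra.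
have [y0 Cy0 H0] : exists2 y : {ffun 'I_n -> bool} -> 'I_n -> R,
    (forall s, Cb b (y s)) &
    p b * cavg (fun s => expR (sqdist (vertex s) (y s) / 9)) <= 1.
  apply: IH; first exact: cCb.
  by apply: contrapT => /cprob_eq0 H; move: pgt0; rewrite /p H ltxx.
set e0 := cavg _ in H0.
(* The heavier face contributes at most [1 / p b]. With this bound on the lighter face, the product
   falls short of [1] by the square [((p b - q) / (2 * p b)) ^+ 2]. *)
suff [y1 Cy1 H1] : exists2 y : {ffun 'I_n -> bool} -> 'I_n.+1 -> R,
    (forall s, C (y s)) &
    cavg (fun s => expR (sqdist (vertex (ffcons (~~ b) s)) (y s) / 9)) <=
    (2 - p (~~ b) / p b) / p b.
  pose tl (s : {ffun 'I_n.+1 -> bool}) : {ffun 'I_n -> bool} :=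
    [ffun i => s (lift ord0 i)].
  have tlK c s : tl (ffcons c s) = s.
    by apply/ffunP => i; rewrite !ffunE fconsS.
  exists (fun s : {ffun 'I_n.+1 -> bool} => if s ord0 == b then fcons b%:R (y0 (tl s)) else y1 (tl s)).
    by move=> s; case: ifP => _; [exact: Cy0|exact: Cy1].
  rewrite pE (cavgS _ b).
  rewrite (_ : cavg _ = e0); last first.
    apply: eq_cavg => s; rewrite tlK vertex_ffcons ffunE fcons0 eqxx.
    by rewrite sqdist_fcons subrr expr0n add0r.
  rewrite (_ : cavg _ = cavg (fun s => expR (sqdist (vertex (ffcons (~~ b) s)) (y1 s) / 9))); last first.
    apply: eq_cavg => s; rewrite tlK ffunE fcons0 (_ : ~~ b == b = false)//.
    by case: (b).
  have : e0 <= (p b)^-1 by rewrite -[leRHS]mul1r ler_pdivlMr// mulrC.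
  move=> /lerD /(_ H1) H.
  set q := p (~~ b) in H *.
  have q0 : 0 <= q by exact: ge0_cprob.
  apply: (@le_trans _ _ ((p b + q) / 2 * (((p b)^-1 + (2 - q / p b) / p b) / 2))).
    by rewrite ler_wpM2l ?ler_pM2r ?divr_ge0 ?addr_ge0// ltW.
  rewrite -subr_ge0.
  have -> : 1 - (p b + q) / 2 * (((p b)^-1 + (2 - q / p b) / p b) / 2) =
    ((p b - q) / (2 * p b)) ^+ 2 by field; rewrite gt_eqF.
  exact: sqr_ge0.
(* If the lighter face has no vertex in its section of [C], the induction hypothesis says nothing
   there. The points of the heavier face are reused, at the cost of a factor
   [expR (1 / 9) <= 9 / 8], which is below the available [2]. *)
have [q0|q0] := eqVneq (p (~~ b)) 0.
  exists (fun s => fcons b%:R (y0 s)) => //.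
  rewrite q0 mul0r subr0.
  rewrite (_ : cavg _ = expR (1 / 9) * e0); last first.
    rewrite -cavgZ; apply: eq_cavg => s; rewrite -expRD; congr expR.
    rewrite vertex_ffcons sqdist_fcons -mulrDl; congr ((_ + _) / 9).
    by case: (b) => /=; rewrite ?subr0 ?sub0r ?sqrrN expr1n.
  rewrite ler_pdivlMr// -mulrA [e0 * _]mulrC -[leRHS]mulr1.
  apply: ler_pM => //; rewrite ?expR_ge0//.
    by rewrite mulr_ge0 ?(ltW pgt0)// ge0_cavg// => s; exact: expR_ge0.
  have := @expR_ge1Dx R (- (1 / 9)); rewrite expRN => H.
  have : (expR (1 / 9))^-1^-1 <= (1 - 1 / 9 :> R)^-1.
    rewrite lef_pV2// posrE; first by rewrite invr_gt0 expR_gt0.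
    lra.
  by rewrite invrK => /le_trans; apply; rewrite invf_ple ?posrE; lra.
have qgt0 : 0 < p (~~ b) by rewrite lt_neqAle eq_sym q0 ge0_cprob.
have [y1 Cy1 H1] : exists2 y : {ffun 'I_n -> bool} -> 'I_n -> R,
    (forall s, Cb (~~ b) (y s)) &
    p (~~ b) * cavg (fun s => expR (sqdist (vertex s) (y s) / 9)) <= 1.
  apply: IH; first exact: cCb.
  by apply: contrapT => /cprob_eq0 H; move: qgt0; rewrite /p H ltxx.
set e1 := cavg _ in H1.
set q := p (~~ b) in qgt0 H1 *.
have [l l01 Hl] := talagrand_weight qgt0 Pb.
exists (fun s => mix l (fcons b%:R (y0 s)) (fcons (~~ b)%:R (y1 s))).
  by move=> s; apply: cC => //; [exact: Cy0|exact: Cy1].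
(* Shifting the exponents by [ln (p b)] and [ln q] makes the convexity of the exponential do the
   work of Hölder's inequality: the averages that appear, [p b * e0] and [q * e1], are at most
   [1]. *)
pose c := expR (l ^+ 2 / 9 - (l * ln (p b) + (1 - l) * ln q)).
apply: (@le_trans _ _ (c * (l * (p b * e0) + (1 - l) * (q * e1)))).
  rewrite -!cavgZ -cavgD -cavgZ; apply: le_cavg => s.
  rewrite mix_fcons vertex_ffcons sqdist_fcons.
  rewrite (_ : (_ - _) ^+ 2 = l ^+ 2); last first.
    by case: (b) => /=; ring.
  set d0 := sqdist (vertex s) (y0 s); set d1 := sqdist (vertex s) (y1 s).
  apply: (@le_trans _ _ (c * expR (l * (d0 / 9 + ln (p b)) + (1 - l) * (d1 / 9 + ln q)))).
    rewrite -expRD ler_expR.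
    have := sqdist_mix (vertex s) (y0 s) (y1 s) l01; rewrite -/d0 -/d1; lra.
  rewrite ler_wpM2l ?expR_ge0//.
  apply: le_trans (expR_convex _ _ l01) _.
  by rewrite !expRD !lnK ?posrE// ![_ * expR (_ / 9)]mulrC.
have {}Hl : c <= (2 - q / p b) / p b.
  rewrite ler_pdivlMr//; apply: le_trans Hl.
  rewrite -[X in c * X]lnK ?posrE// -expRD ler_expR; lra.
move: l01 => /andP[l0 l1].
rewrite -[leRHS]mulr1; apply: ler_pM; rewrite ?expR_ge0//.
  have e0ge : 0 <= e0 by apply: ge0_cavg => s; exact: expR_ge0.
  have e1ge : 0 <= e1 by apply: ge0_cavg => s; exact: expR_ge0.
  by rewrite addr_ge0// mulr_ge0 ?subr_ge0// mulr_ge0// ltW.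
apply: (@le_trans _ _ (l * 1 + (1 - l) * 1)); last by rewrite !mulr1 subrKC.
by rewrite lerD// ler_wpM2l// ?subr_ge0.
Qed.

(** Markov's inequality for the exponential moment of the distance. A lower bound on either
    probability becomes an upper bound on the other, and both uses occur below. *)
Lemma convex_concentration n (C : ('I_n -> R) -> Prop) (D : {ffun 'I_n -> bool} -> Prop)
    (delta : R) :
  convex_pred C -> (forall s y, D s -> C y -> delta <= sqdist (vertex s) y) ->
  cprob (fun s => C (vertex s)) * cprob D <= expR (- (delta / 9)).
Proof.
move=> cC DC.
have [/(talagrand_convex_distance cC)[y Cy H]|/cprob_eq0 ->] :=
    pselect (exists s, C (vertex s)); last by rewrite mul0r expR_ge0.
rewrite expRN -[leRHS]mul1r ler_pdivlMr ?expR_gt0//.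
apply: le_trans H; rewrite -mulrA ler_wpM2l ?ge0_cprob// mulrC.
apply: cprob_markov => s; first exact: expR_ge0.
by move=> /DC /(_ (Cy s)); rewrite ler_expR => H; lra.
Qed.

End Cube.

(** * Randomly swapping two samples *)

Lemma pos512 (R : realType) : 0 < 512 :> R.
Proof. by rewrite ltr0n. Qed.

Section Swap.
Variables (R : realType) (n : nat) (T : Type).
Local Notation cube := {ffun 'I_n -> bool}.

Lemma ler_norm_mix (l x y : R) : 0 <= l <= 1 ->
  `|l * x + (1 - l) * y| <= l * `|x| + (1 - l) * `|y|.
Proof.
move=> /andP[l0 l1]; apply: le_trans (ler_normD _ _) _.
have l1' : 0 <= 1 - l by rewrite subr_ge0.
by rewrite !normrM (ger0_norm l0) (ger0_norm l1').
Qed.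

(** Cauchy-Schwarz in its arithmetic-geometric form: the free parameter [u] avoids square roots. *)
Lemma ler_norm_dot (c d : 'I_n -> R) (u v : R) : 0 < u -> 0 < v ->
  \sum_i d i ^+ 2 <= v ->
  `|\sum_i c i * d i| <= v / (2 * u) * \sum_i c i ^+ 2 + u / 2.
Proof.
move=> u0 v0 dv; apply: le_trans (ler_norm_sum _ _ _) _.
apply: (@le_trans _ _ (\sum_i (v / (2 * u) * c i ^+ 2 + u / (2 * v) * d i ^+ 2))).
  apply: ler_sum => i _; rewrite normrM -(real_normK (num_real (c i))) -(real_normK (num_real (d i))).
  rewrite -subr_ge0.
  have -> : v / (2 * u) * `|c i| ^+ 2 + u / (2 * v) * `|d i| ^+ 2 - `|c i| * `|d i| =
    (v * `|c i| - u * `|d i|) ^+ 2 / (2 * u * v) by field; rewrite !gt_eqF.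
  by rewrite divr_ge0 ?sqr_ge0// !mulr_ge0// ltW.
rewrite big_split/= -!mulr_sumr lerD2l.
have -> : u / 2 = u / (2 * v) * v by field; rewrite gt_eqF.
by rewrite ler_wpM2l// divr_ge0 ?mulr_ge0// ltW.
Qed.

Variables (M : T -> Prop) (a b : T -> 'I_n -> R) (v : R).
Hypothesis v0 : 0 < v.
Hypothesis a01 : forall m i, 0 <= a m i <= 1.
Hypothesis b01 : forall m i, 0 <= b m i <= 1.
Hypothesis abv : forall m, M m -> \sum_i (a m i + b m i) <= v.

(** The numbers [a m i] and [b m i] stand for the values of the function [m] at the [i]-th points of
    the sample and of the ghost sample; [s] marks the exchanged coordinates. *)
Definition swapped (s : cube) m i := if s i then b m i else a m i.

Definition flip (e s : cube) : cube := [ffun i => s i (+) e i].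

Definition compl (s : cube) : cube := [ffun i => ~~ s i].

(** The affine extension of [swapped] from the vertices to the whole space, as convexity arguments
    require. *)
Definition interp (y : 'I_n -> R) m i := (1 - y i) * a m i + y i * b m i.

(** Bounding this for every selection [phi] amounts to bounding the average of the supremum over
    indices. *)
Definition rad_mean (phi : cube -> T) y := cavg (fun e : cube => `|\sum_i (-1) ^+ e i * interp y (phi e) i|).

Lemma interp_vertex s m i : interp (vertex R s) m i = swapped s m i.
Proof. by rewrite /interp /vertex /swapped; case: (s i) => /=; ring. Qed.

Lemma swapped_ge0 s m i : 0 <= swapped s m i.
Proof. by rewrite /swapped; case: ifP => _; [case/andP: (b01 m i)|case/andP: (a01 m i)]. Qed.

(** For numbers in [[0, 1]], [(b - a) ^+ 2 <= a + b]. Localization enters here: Lipschitz constants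
    are governed by [v] rather than by [n]. *)
Lemma sqr_diff_le m : M m -> \sum_i (b m i - a m i) ^+ 2 <= v.
Proof.
move=> Mm; apply: le_trans (abv Mm); apply: ler_sum => i _.
by have /andP[? ?] := a01 m i; have /andP[? ?] := b01 m i; nra.
Qed.

Lemma rad_mean_convex (w : R) :
  convex_pred (fun y => forall phi, (forall e, M (phi e)) -> rad_mean phi y <= w).
Proof.
move=> l x y l01 Cx Cy phi Mphi; have /andP[l0 l1] := l01.
apply: (@le_trans _ _ (l * rad_mean phi x + (1 - l) * rad_mean phi y)); last first.
  apply: (@le_trans _ _ (l * w + (1 - l) * w)); last by rewrite -mulrDl subrKC mul1r.
  by rewrite lerD// ler_wpM2l ?subr_ge0//; [exact: Cx|exact: Cy].
rewrite /rad_mean -!cavgZ -cavgD; apply: le_cavg => e.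
apply: le_trans (ler_norm_mix _ _ l01); rewrite !mulr_sumr -big_split/=.
by rewrite le_eqVlt; apply/orP; left; apply/eqP; congr (`| _ |); apply: eq_bigr => i _; rewrite /interp /mix; ring.
Qed.

(** As a function of the point, [rad_mean phi] is Lipschitz with constant [sqrt v], so a drop from
    [2 * w] to [w] takes a distance of at least [w / sqrt v]. *)
Lemma rad_mean_dist (w : R) s y : 0 < w ->
  (exists2 phi, (forall e, M (phi e)) & 2 * w <= rad_mean phi (vertex R s)) ->
  (forall phi, (forall e, M (phi e)) -> rad_mean phi y <= w) ->
  w ^+ 2 / v <= sqdist (vertex R s) y.
Proof.
move=> w0 [phi Mphi Ws] /(_ _ Mphi) Wy.
suff H : rad_mean phi (vertex R s) <=
    rad_mean phi y + (v / (2 * w) * sqdist (vertex R s) y + w / 2).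
  have {}H : w / 2 <= v / (2 * w) * sqdist (vertex R s) y by lra.
  rewrite ler_pdivrMr//.
  have := ler_wpM2l (ltW w0) H.
  have -> : w * (v / (2 * w) * sqdist (vertex R s) y) = v * sqdist (vertex R s) y / 2.
    by field; rewrite gt_eqF.
  by rewrite expr2; lra.
rewrite -[X in _ + X](@cavg_cst R n) -cavgD; apply: le_cavg => e.
have -> : \sum_i (-1) ^+ e i * interp (vertex R s) (phi e) i =
  \sum_i (-1) ^+ e i * interp y (phi e) i +
  \sum_i (vertex R s i - y i) * ((-1) ^+ e i * (b (phi e) i - a (phi e) i)).
  by rewrite -big_split; apply: eq_bigr => i _ /=; rewrite /interp; move: ((-1) ^+ _) => c; ring.
apply: le_trans (ler_normD _ _) _; rewrite lerD2l; apply: ler_norm_dot => //.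
under eq_bigr do rewrite exprMn sqrr_sign mul1r.
exact: sqr_diff_le.
Qed.

Lemma sum_swapped_le s m : M m -> \sum_i swapped s m i <= v.
Proof.
move=> Mm; apply: le_trans (abv Mm); apply: ler_sum => i _; rewrite /swapped.
by have /andP[? ?] := a01 m i; have /andP[? ?] := b01 m i; case: ifP; lra.
Qed.

Lemma rad_mean_le phi s : (forall e, M (phi e)) -> rad_mean phi (vertex R s) <= v.
Proof.
move=> Mphi; rewrite -[leRHS](@cavg_cst R n); apply: le_cavg => e.
apply: le_trans (ler_norm_sum _ _ _) _.
apply: le_trans (sum_swapped_le s (Mphi e)); apply: ler_sum => i _.
by rewrite normrM normr_sign mul1r interp_vertex ger0_norm// swapped_ge0.
Qed.

Definition swap_dev s m := `|\sum_i (swapped s m i - swapped (compl s) m i)|.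

Lemma swapped_flip e s m i : swapped (flip e s) m i - swapped (compl (flip e s)) m i =
  (-1) ^+ e i * (swapped s m i - swapped (compl s) m i).
Proof.
by rewrite /swapped !ffunE; case: (s i); case: (e i) => /=; ring.
Qed.

Lemma flip_involutive e : involutive (flip e).
Proof. by move=> s; apply/ffunP => i; rewrite !ffunE -addbA addbb addbF. Qed.

Lemma compl_involutive : involutive compl.
Proof. by move=> s; apply/ffunP => i; rewrite !ffunE negbK. Qed.

(* Symmetrization: flipping the swaps by an independent [e] splits the
   difference into two Rademacher sums. *)
Lemma cavg_swap_dev_le (psi : cube -> T) (w : R) : 0 <= w -> (forall s, M (psi s)) ->
  cavg (fun s => swap_dev s (psi s)) <= 4 * w + 2 * (v *
    cprob R (fun s => exists2 phi, (forall e, M (phi e)) & 2 * w <= rad_mean phi (vertex R s))).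
Proof.
move=> w0 Mpsi; set D := fun s => exists2 _, _ & _.
rewrite -[leLHS](@cavg_cst R n).
rewrite (_ : cavg _ = cavg (fun e => cavg (fun s => swap_dev (flip e s) (psi (flip e s))))); last first.
  by apply: eq_cavg => e; exact: (cavg_inv _ (flip_involutive e)).
rewrite exchange_cavg.
apply: (@le_trans _ _ (cavg (fun s => (2 * w + v * `[< D s >]%:R) + (2 * w + v * `[< D (compl s) >]%:R)))); last first.
  rewrite !cavgD !cavgZ !cavg_cst -(cavg_inv (fun s => `[< D s >]%:R) compl_involutive).
  by rewrite -/(cprob R D); lra.
apply: le_cavg => s.
(* Outside [D] no selection reaches [2 * w]; on [D] the trivial bound [v] is used. *)
have radD phi s' : (forall e, M (phi e)) -> rad_mean phi (vertex R s') <= 2 * w + v * `[< D s' >]%:R.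
  move=> Mphi; case: asboolP => [Ds|nDs].
    by rewrite mulr1 (le_trans (rad_mean_le _ Mphi))// lerDr mulr_ge0.
  by rewrite mulr0 addr0 leNgt; apply/negP => /ltW H; apply: nDs; exists phi.
pose phi e := psi (flip e s).
have Mphi e : M (phi e) by exact: Mpsi.
apply: le_trans (lerD (radD phi s Mphi) (radD phi (compl s) Mphi)).
rewrite /rad_mean -cavgD; apply: le_cavg => e; rewrite /swap_dev.
under eq_bigr do rewrite swapped_flip mulrBr.
rewrite sumrB; apply: le_trans (ler_normB _ _) _.
by apply: lerD; rewrite le_eqVlt; apply/orP; left; apply/eqP; congr (`|_|);
  apply: eq_bigr => i _; rewrite interp_vertex.
Qed.

Lemma swap_dev_convex (z : R) : convex_pred (fun y => forall m, M m ->
  `|\sum_i (1 - 2 * y i) * (a m i - b m i)| <= z).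
Proof.
move=> l x y l01 Cx Cy m Mm; have /andP[l0 l1] := l01.
have l1' : 0 <= 1 - l by rewrite subr_ge0.
apply: (@le_trans _ _ (l * z + (1 - l) * z)); last by rewrite -mulrDl subrKC mul1r.
apply: le_trans (lerD (ler_wpM2l l0 (Cx m Mm)) (ler_wpM2l l1' (Cy m Mm))).
apply: le_trans (ler_norm_mix _ _ l01); rewrite !mulr_sumr -big_split/=.
by rewrite le_eqVlt; apply/orP; left; apply/eqP; congr (`| _ |); apply: eq_bigr => i _; rewrite /mix; ring.
Qed.

Lemma swap_devE s m : swap_dev s m = `|\sum_i (1 - 2 * vertex R s i) * (a m i - b m i)|.
Proof.
congr (`|_|); apply: eq_bigr => i _.
by rewrite /swapped /vertex !ffunE; case: (s i) => /=; ring.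
Qed.

(** The Lipschitz argument again, with slopes [2 * (b - a)], whence the factor [4]. *)
Lemma swap_dev_dist (z : R) s y : 0 < z ->
  (exists2 m, M m & 2 * z <= swap_dev s m) ->
  (forall m, M m -> `|\sum_i (1 - 2 * y i) * (a m i - b m i)| <= z) ->
  z ^+ 2 / (4 * v) <= sqdist (vertex R s) y.
Proof.
move=> z0 [m Mm]; rewrite swap_devE => Zs /(_ _ Mm) Zy.
suff H : `|\sum_i (1 - 2 * vertex R s i) * (a m i - b m i)| <=
    `|\sum_i (1 - 2 * y i) * (a m i - b m i)| +
    (4 * v / (2 * z) * sqdist (vertex R s) y + z / 2).
  have {}H : z / 2 <= 4 * v / (2 * z) * sqdist (vertex R s) y by lra.
  rewrite ler_pdivrMr ?mulr_gt0//.
  have := ler_wpM2l (ltW z0) H.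
  have -> : z * (4 * v / (2 * z) * sqdist (vertex R s) y) = 4 * v * sqdist (vertex R s) y / 2.
    by field; rewrite gt_eqF.
  by rewrite expr2; lra.
have -> : \sum_i (1 - 2 * vertex R s i) * (a m i - b m i) =
  \sum_i (1 - 2 * y i) * (a m i - b m i) +
  \sum_i (vertex R s i - y i) * (2 * (b m i - a m i)).
  by rewrite -big_split; apply: eq_bigr => i _ /=; ring.
apply: le_trans (ler_normD _ _) _; rewrite lerD2l; apply: ler_norm_dot => //.
  by rewrite mulr_gt0.
under eq_bigr do rewrite exprMn.
by rewrite -mulr_sumr (_ : 2 ^+ 2 = 4) ?ler_wpM2l ?sqr_diff_le//; ring.
Qed.

(* Either the Rademacher averages [W] exceed [2 * (v / 512)] with probability at
   least [1 / 256], and then [W <= v / 512] is a large deviation; or the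
   symmetrization bound puts the deviations below [v / 32] with probability at
   least [1 / 2], and then [v / 16] is a large deviation. *)
Lemma swap_concentration :
  cprob R (fun s =>
    (exists2 m, M m & v / 16 <= `|\sum_i (swapped s m i - swapped (compl s) m i)|) /\
    (forall phi : cube -> T, (forall e, M (phi e)) ->
      cavg (fun e : cube => `|\sum_i (-1) ^+ e i * swapped s (phi e) i|) <= v / 512))
  <= 256 * expR (- (v / 512 ^+ 2 / 9)).
Proof.
have [[m0 Mm0]|nM] := pselect (exists m, M m); last first.
  rewrite cprob_eq0; first by apply: mulr_ge0; [rewrite ler0n|exact: expR_ge0].
  by move=> [s [[m Mm _] _]]; apply: nM; exists m.
set D := fun s => exists2 phi, (forall e, M (phi e)) & 2 * (v / 512) <= rad_mean phi (vertex R s).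
have w0 : 0 < v / 512 := divr_gt0 v0 (pos512 R).
have [PD|PD] := leP (1 / 256) (cprob R D).
  pose C y := forall phi, (forall e, M (phi e)) -> rad_mean phi y <= v / 512.
  apply: (@le_trans _ _ (cprob R (fun s => C (vertex R s)))).
    apply: le_cprob => s [_ H] phi /H {}H; apply: le_trans H.
    apply: le_cavg => e; under eq_bigr do rewrite interp_vertex.
    exact: lexx.
  have := @convex_concentration R n C D ((v / 512) ^+ 2 / v) (@rad_mean_convex _)
    (fun s y => rad_mean_dist w0).
  have -> : (v / 512) ^+ 2 / v = v / 512 ^+ 2 by field; rewrite gt_eqF.
  have p0 := @ge0_cprob R n (fun s => C (vertex R s)).
  set p := cprob R (fun s => C (vertex R s)) in p0 *; set E := expR _ => H.
  have : p * (1 / 256) <= E by apply: le_trans H; rewrite ler_wpM2l.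
  lra.
have z0 : 0 < v / 32 by rewrite divr_gt0.
pose D2 s := exists2 m, M m & v / 32 <= swap_dev s m.
(* A witness of the deviation on [D2], and the default [m0] elsewhere, so that [psi] takes values in
   [M] everywhere. *)
have [psi psiP] : {psi : cube -> T & forall s, M (psi s) /\ (D2 s -> v / 32 <= swap_dev s (psi s))}.
  apply: (@choice _ _ (fun s m => M m /\ (D2 s -> v / 32 <= swap_dev s m))) => s.
  have [[m Mm H]|nD] := pselect (D2 s); first by exists m.
  by exists m0.
(* The mean deviation is at most [4 * (v / 512) + 2 * (v / 256) = v / 64], half of the threshold
   [v / 32]. *)
have PD2 : cprob R D2 <= 1 / 2.
  have := @cprob_markov R n (fun s => swap_dev s (psi s)) (v / 32) D2 (fun=> normr_ge0 _)
    (fun s => (psiP s).2).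
  move=> /le_trans /(_ (cavg_swap_dev_le (ltW w0) (fun s => (psiP s).1))).
  rewrite -/D => H.
  have : v * cprob R D <= v * (1 / 256) by rewrite ler_wpM2l// ltW.
  move=> H'; rewrite -(ler_pM2l z0); lra.
pose C y := forall m, M m -> `|\sum_i (1 - 2 * y i) * (a m i - b m i)| <= v / 32.
have PC : 1 / 2 <= cprob R (fun s => C (vertex R s)).
  apply: (@le_trans _ _ (cprob R (fun s => ~ D2 s))); first by rewrite cprobC; lra.
  apply: le_cprob => s nD m Mm; rewrite -swap_devE leNgt; apply/negP => /ltW H.
  by apply: nD; exists m.
pose DZ s := exists2 m, M m & 2 * (v / 32) <= swap_dev s m.
apply: (@le_trans _ _ (cprob R DZ)).
  apply: le_cprob => s [[m Mm H] _]; exists m => //; apply: le_trans H; lra.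
have := @convex_concentration R n C DZ ((v / 32) ^+ 2 / (4 * v)) (@swap_dev_convex _)
    (fun s y => swap_dev_dist z0).
have -> : (v / 32) ^+ 2 / (4 * v) = v / 64 ^+ 2 by field; rewrite gt_eqF.
have p0 := @ge0_cprob R n DZ.
have : expR (- (v / 64 ^+ 2 / 9)) <= expR (- (v / 512 ^+ 2 / 9)).
  rewrite ler_expR lerN2 ler_pM2r ?invr_gt0 ?ltr0n// ler_pM2l// lef_pV2 ?posrE; last 2 first.
  - exact: exprn_gt0 (pos512 R).
  - by rewrite exprn_gt0// ltr0n.
  by rewrite lerXn2r ?nnegrE ?ler0n// ler_nat.
have := expR_ge0 (- (v / 512 ^+ 2 / 9)).
move=> H1 H2 H3.
have : 1 / 2 * cprob R DZ <= cprob R (fun s => C (vertex R s)) * cprob R DZ by rewrite ler_wpM2r.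
lra.
Qed.

End Swap.

(** * The fixed point of a concave modulus *)

Section FixedPoint.
Variables (R : realType) (psi : R -> R).
Hypothesis psi0 : psi 0 = 0.
Hypothesis psi_nd : forall a b, 0 <= a -> a <= b -> psi a <= psi b.
Hypothesis psi_concave : concave_on_nonneg psi.

(** Concavity on the segment from [0], where [psi] vanishes, to [t]: the slope [psi t / t] is
    non-increasing. *)
Lemma concave_ratio (s t : R) : 0 < s -> s <= t -> s * psi t <= t * psi s.
Proof.
move=> s0 st; have t0 : 0 < t by exact: lt_le_trans st.
have /psi_concave : 0 <= t by exact: ltW.
move=> /(_ 0 (s / t) (lexx _)); rewrite psi0 !mulr0 !addr0 divfK ?gt_eqF//.
rewrite divr_ge0 ?ler_pdivrMr ?mul1r ?(ltW s0) ?(ltW t0)// st => /(_ isT).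
by rewrite mulrAC ler_pdivrMr// [psi s * t]mulrC.
Qed.

(** The fixed point is the supremum of the [x] with [x ^+ 2 <= psi x]. By [concave_ratio] this set
    contains a positive number and is bounded; monotonicity of [psi] gives the two inequalities at
    the supremum. *)
Lemma positive_fixed_point (s : R) : 0 < s -> 0 < psi s ->
  exists2 r, 0 < r & r ^+ 2 = psi r.
Proof.
move=> s0 ps0.
pose E := [set x : R | 0 <= x /\ x ^+ 2 <= psi x].
pose s2 := Num.min s (psi s / s).
have s20 : 0 < s2 by rewrite lt_min s0 divr_gt0.
have Es2 : E s2.
  split; first exact: ltW.
  have H : s2 * psi s <= s * psi s2 by apply: concave_ratio => //; rewrite ge_min lexx.
  have H2 : s2 * s <= psi s by rewrite -ler_pdivlMr// ge_min lexx orbT.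
  rewrite -(ler_pM2l s0); apply: le_trans H; rewrite expr2 mulrCA.
  by rewrite ler_pM2l// mulrC.
have bE : has_ubound E.
  exists (Num.max s (psi s / s)) => x [x0 Ex]; rewrite le_max.
  have [//|sx] := leP x s; rewrite ler_pdivlMr//=.
  have H : s * psi x <= x * psi s by apply: concave_ratio => //; exact: ltW.
  have x0' : 0 < x by exact: lt_trans sx.
  rewrite -(ler_pM2l x0'); apply: le_trans H; rewrite mulrA -expr2 mulrC.
  by rewrite ler_pM2l.
have sE : has_sup E by split => //; exists s2.
have r0 : 0 < sup E by apply: lt_le_trans s20 _; exact: ub_le_sup.
exists (sup E) => //; apply/le_anti/andP; split.
  apply/ler_addgt0Pr => e e0.
  (* This keeps [sup E - del] nonnegative and its square within [e] of [sup E ^+ 2]. *)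
  pose del := Num.min (sup E) (e / (2 * sup E)).
  have d0 : 0 < del by rewrite lt_min r0 divr_gt0// mulr_gt0.
  have [x [x0 Ex] dx] := sup_adherent d0 sE.
  have xs : x <= sup E by exact: ub_le_sup.
  have : psi x <= psi (sup E) by exact: psi_nd.
  have : del <= sup E by rewrite ge_min lexx.
  have : del * (2 * sup E) <= e.
    by rewrite -ler_pdivlMr ?mulr_gt0// ge_min lexx orbT.
  move=> H1 H2 H3.
  have : (sup E - del) ^+ 2 <= x ^+ 2 by rewrite ler_pXn2r ?nnegrE ?subr_ge0// ltW.
  have : 0 <= del ^+ 2 by rewrite sqr_ge0.
  rewrite !expr2 in Ex *; lra.
apply/ler_addgt0Pr => e e0.
pose del := Num.min 1 (e / (2 * sup E + 1)).
have d0 : 0 < del by rewrite lt_min ltr01 divr_gt0// ltr_wpDl// mulr_ge0// ltW.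
have H : psi (sup E + del) < (sup E + del) ^+ 2.
  rewrite ltNge; apply/negP => H.
  have /(ub_le_sup bE) : E (sup E + del) by split => //; rewrite addr_ge0// ltW.
  lra.
have : psi (sup E) <= psi (sup E + del) by apply: psi_nd; lra.
have : del <= 1 by rewrite ge_min lexx.
have : del * (2 * sup E + 1) <= e.
  by rewrite -ler_pdivlMr ?ltr_wpDl ?mulr_ge0 ?(ltW r0)// ge_min lexx orbT.
move=> H1 H2 H3.
have : del * del <= del * 1 by rewrite ler_pM2l.
rewrite !expr2 in H *; lra.
Qed.

(** By [concave_ratio] from [sqrt rh] to [sqrt r], the left side is at most
    [(sqrt r / sqrt rh) * rh]. If [rh = 0] the ratio degenerates, and a positive value of [psi]
    would yield a fixed point above the largest one. *)
Lemma above_fixed_point (rh r : R) : 0 <= rh -> rh = psi (Num.sqrt rh) ->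
  (forall r, 0 <= r -> r = psi (Num.sqrt r) -> r <= rh) ->
  rh <= r -> psi (Num.sqrt r) <= Num.sqrt (r * rh).
Proof.
move=> rh0 rhE rhmax rhr; have r0 : 0 <= r by exact: le_trans rhr.
have [rhz|rhn] := eqVneq rh 0.
  rewrite rhz mulr0 sqrtr0 leNgt; apply/negP => ps.
  have sr : 0 < Num.sqrt r.
    rewrite lt_neqAle sqrtr_ge0 andbT eq_sym; apply/eqP => H.
    by move: ps; rewrite H psi0 ltxx.
  have [x x0 xE] := positive_fixed_point sr ps.
  have := rhmax (x ^+ 2) (sqr_ge0 _).
  rewrite sqrtr_sqr (gtr0_norm x0) => /(_ xE); rewrite rhz leNgt.
  by rewrite exprn_gt0.
have sh0 : 0 < Num.sqrt rh by rewrite sqrtr_gt0 lt_neqAle eq_sym rhn.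
have := @concave_ratio (Num.sqrt rh) (Num.sqrt r) sh0.
rewrite ler_wsqrtr// => /(_ isT); rewrite -rhE -[X in _ <= _ * X](sqr_sqrtr rh0).
rewrite expr2 mulrCA ler_pM2l// => /le_trans; apply.
by rewrite sqrtrM.
Qed.

End FixedPoint.

(** * Chebyshev's inequality and the ghost sample *)

Section Sample.
Context (d d' : measure_display) (R : realType) (S : measurableType d)
  (Omega : measurableType d') (Pr : probability Omega R) (P : probability S R)
  (n : nat) (X : 'I_n -> Omega -> S).
Hypothesis mX : forall i, measurable_fun setT (X i).
Hypothesis distX : forall i, has_distribution Pr P (X i).
Hypothesis indX : mutually_independent Pr X.

Lemma integral_sample (i : 'I_n) (f : S -> \bar R) : measurable_fun setT f ->
  (forall s, (0 <= f s)%E) -> (\int[Pr]_w f (X i w) = \int[P]_s f s)%E.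
Proof.
move=> mf f0.
pose Xi : {mfun Omega >-> S} := HB.pack (X i) (isMeasurableFun.Build _ _ _ _ _ (mX i)).
have := @ge0_integral_distribution _ _ _ _ _ Pr Xi f mf f0 => /= <-.
by apply: eq_measure_integral => A mA _; exact: distX.
Qed.

Lemma independent_pair (i j : 'I_n) (A B : set S) : i != j ->
  measurable A -> measurable B ->
  (Pr [set w | A (X i w) /\ B (X j w)] = P A * P B)%E.
Proof.
move=> ij mA mB.
pose C k := if k == i then A else if k == j then B else setT.
have mC k : measurable (C k).
  by rewrite /C; case: ifP => // _; case: ifP.
have := indX mC; rewrite (bigD1 i)//= (bigD1 j)//= 1?eq_sym//.
rewrite /C eqxx [j == i]eq_sym (negbTE ij) eqxx.
rewrite big1 ?mule1; last first.
  move=> k /andP[/negbTE -> /negbTE ->].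
  by rewrite preimage_setT probability_setT.
rewrite !distX// => <-; congr (Pr _); apply/seteqP; split => w /=.
  move=> [Aw Bw] k; case: eqP => [->//|_]; by case: eqP => [->|].
by move=> H; have := H i; have := H j; rewrite !eqxx [j == i]eq_sym (negbTE ij).
Qed.

(** The pair of sample points has law [P \x P], as the two measures agree on products of sets;
    Tonelli's theorem then factors the integral. *)
Lemma integral_sample2 (i j : 'I_n) (g : S -> R) (mu : R) : i != j ->
  measurable_fun setT g -> (forall s, 0 <= g s) ->
  (\int[P]_s (g s)%:E = mu%:E)%E ->
  (\int[Pr]_w (g (X i w) * g (X j w))%:E = (mu ^+ 2)%:E)%E.
Proof.
move=> ij mg g0 gmu.
have mXX : measurable_fun setT (fun w => (X i w, X j w)).
  by apply/measurable_fun_pairP; split; exact: mX.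
pose XX : {mfun Omega >-> (S * S)%type} :=
  HB.pack (fun w => (X i w, X j w)) (isMeasurableFun.Build _ _ _ _ _ mXX).
pose f (z : S * S) := (g z.1 * g z.2)%:E.
have mf : measurable_fun setT f.
  by apply/measurable_EFinP/measurable_funM; apply: measurableT_comp.
have f0 z : (0 <= f z)%E by rewrite lee_fin mulr_ge0.
have := @ge0_integral_distribution _ _ _ _ _ Pr XX f mf f0 => /= <-.
rewrite (eq_measure_integral (P \x P)%E); last first.
  move=> A mA _; apply/esym; apply: product_measure_unique => // A' B' mA' mB'.
  exact: independent_pair.
rewrite fubini_tonelli1// /fubini_F.
transitivity (\int[P]_x (mu%:E * (g x)%:E))%E.
  apply: eq_integral => x _; rewrite -gmu muleC -ge0_integralZl_EFin//.
  - by move=> y _; rewrite lee_fin.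
  - exact/measurable_EFinP.
have mu0 : 0 <= mu by rewrite -lee_fin -gmu integral_ge0// => s _; rewrite lee_fin.
rewrite ge0_integralZl_EFin//.
- by rewrite gmu expr2.
- by move=> y _; rewrite lee_fin.
- exact/measurable_EFinP.
Qed.

Definition sample_sum (g : S -> R) w := \sum_(i < n) g (X i w).

Lemma measurable_sample_sum g : measurable_fun setT g -> measurable_fun setT (sample_sum g).
Proof.
move=> mg; apply: measurable_sum => i; exact: measurableT_comp.
Qed.

(** Expanding the square, an off-diagonal pair contributes [mu ^+ 2], and a diagonal one at most
    [mu] because [g ^+ 2 <= g]. *)
Lemma second_moment_sample_sum (g : S -> R) (mu : R) :
  measurable_fun setT g -> (forall s, 0 <= g s <= 1) ->
  (\int[P]_s (g s)%:E = mu%:E)%E ->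
  (\int[Pr]_w (sample_sum g w ^+ 2)%:E <= ((n%:R * mu) ^+ 2 + n%:R * mu)%:E)%E.
Proof.
move=> mg g01 gmu.
have g0 s : 0 <= g s by case/andP: (g01 s).
have mu0 : 0 <= mu by rewrite -lee_fin -gmu integral_ge0// => s _; rewrite lee_fin.
rewrite (eq_integral (fun w => \sum_(p <- enum {: 'I_n * 'I_n}) (g (X p.1 w) * g (X p.2 w))%:E)%E); last first.
  move=> w _; rewrite sumEFin; congr (_%:E).
  rewrite expr2 /sample_sum big_distrlr/= pair_big/= big_enum//=.
rewrite ge0_integral_sum//; last 2 first.
- move=> p; apply/measurable_EFinP/measurable_funM; exact: measurableT_comp.
- by move=> p w _; rewrite lee_fin mulr_ge0.
rewrite big_enum/=.
apply: (@le_trans _ _ (\sum_(p : 'I_n * 'I_n) (mu ^+ 2 + (p.1 == p.2)%:R * mu)%:E)%E).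
  apply: lee_sum => -[i j] _ /=; have [<-|ij] := eqVneq i j; last first.
    by rewrite (integral_sample2 ij mg g0 gmu) mul0r addr0.
  rewrite mul1r; apply: (@le_trans _ _ mu%:E); last by rewrite lee_fin lerDr sqr_ge0.
  rewrite -gmu -(integral_sample i (f := EFin \o g)); last 2 first.
  - exact/measurable_EFinP.
  - by move=> s; rewrite lee_fin.
  apply: ge0_le_integral => //.
  - by move=> w _; rewrite lee_fin mulr_ge0.
  - apply/measurable_EFinP/measurable_funM; exact: measurableT_comp.
  - apply/measurable_EFinP; exact: measurableT_comp.
  - by move=> w _; rewrite lee_fin ler_piMr//; case/andP: (g01 (X i w)).
rewrite sumEFin lee_fin big_split/= sumr_const card_prod card_ord.
rewrite -(pair_big xpredT xpredT (fun i j : 'I_n => (i == j)%:R * mu))/=.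
under [X in _ + X <= _]eq_bigr => i _.
  rewrite (bigD1 i)//= eqxx mul1r big1 ?addr0; last first.
    by move=> j; rewrite eq_sym => /negbTE ->; rewrite mul0r.
  over.
by rewrite sumr_const card_ord exprMn -[mu ^+ 2 *+ _]mulr_natl natrM -expr2 mulr_natl.
Qed.

(** Chebyshev: the variance of the sum is at most its mean [c], so a deviation of [c / 2] has
    probability at most [4 / c <= 1 / 2]. *)
Lemma emp_mean_concentration (g : S -> R) (mu : R) :
  measurable_fun setT g -> (forall s, 0 <= g s <= 1) ->
  (\int[P]_s (g s)%:E = mu%:E)%E -> 8 <= n%:R * mu ->
  ((1 / 2)%:E <= Pr [set w | (n%:R * mu / 2 <= sample_sum g w <= 3 * (n%:R * mu / 2))%R])%E.
Proof.
move=> mg g01 gmu; set c := n%:R * mu => c8.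
have g0 s : 0 <= g s by case/andP: (g01 s).
have mu0 : 0 <= mu by rewrite -lee_fin -gmu integral_ge0// => s _; rewrite lee_fin.
set B := [set w | _].
have mS := measurable_sample_sum mg.
have mB : measurable B.
  have -> : B = (sample_sum g @^-1` `[c / 2, 3 * (c / 2)]).
    by apply/seteqP; split => w; rewrite /B /= in_itv.
  by rewrite -[X in measurable X]setTI; apply: mS.
have mCB : measurable (~` B) by exact: measurableC.
suff : (Pr (~` B) <= (1 / 2)%:E)%E.
  rewrite probability_setC// => H.
  have : Pr B \is a fin_num by exact: fin_num_measure.
  move=> /fineK PB; move: H; rewrite -PB -EFinB !lee_fin; lra.
have S0 w : 0 <= sample_sum g w by apply: sumr_ge0.
have ES : (\int[Pr]_w (sample_sum g w)%:E = c%:E)%E.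
  under eq_integral do rewrite /sample_sum -sumEFin -big_enum/=.
  rewrite ge0_integral_sum//; last 2 first.
  - by move=> i; apply/measurable_EFinP; exact: measurableT_comp.
  - by move=> i w _; rewrite lee_fin.
  under eq_bigr.
    move=> i _; rewrite (integral_sample i (f := EFin \o g)) ?gmu; last 2 first.
    - exact/measurable_EFinP.
    - by move=> s; rewrite lee_fin.
    over.
  rewrite big_enum/= sumEFin sumr_const card_ord /c mulr_natl//.
(* The pointwise bound [(c / 2) ^+ 2 <= (sample_sum g w - c) ^+ 2] off [B], with the cross term
   moved to the left so that only nonnegative functions are integrated. *)
have H : (\int[Pr]_w ((c / 2) ^+ 2 * \1_(~` B) w + 2 * c * sample_sum g w)%:E <=
    \int[Pr]_w (sample_sum g w ^+ 2 + c ^+ 2)%:E)%E.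
  apply: ge0_le_integral => //.
  - by move=> w _; rewrite lee_fin addr_ge0 ?mulr_ge0// ?sqr_ge0//; lra.
  - apply/measurable_EFinP; apply: measurable_funD; apply: measurable_funM => //.
  - by apply/measurable_EFinP; apply: measurable_funD => //; apply: measurable_funX.
  - move=> w _; rewrite lee_fin indicE in_setC.
    have sq := sqr_ge0 (sample_sum g w - c).
    have [wB|wB] := boolP (w \in B); first by rewrite mulr0 !expr2 in sq *; lra.
    rewrite mulr1; move: wB; rewrite notin_setE /B /= => /negP.
    rewrite negb_and -!ltNge => /orP[] HS; rewrite !expr2 in sq *; nra.
move: H; under eq_integral do rewrite EFinD EFinM [(_ * sample_sum _ _)%:E]EFinM.
under [X in (_ <= X)%E]eq_integral do rewrite EFinD.
rewrite ge0_integralD//; last 4 first.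
- by move=> w _; rewrite -EFinM lee_fin mulr_ge0 ?sqr_ge0.
- by apply/measurable_EFinP; apply: measurable_funM.
- by move=> w _; rewrite -EFinM lee_fin mulr_ge0//; lra.
- by apply/measurable_EFinP; apply: measurable_funM.
rewrite ge0_integralD//; last 3 first.
- by move=> w _; rewrite lee_fin sqr_ge0.
- by apply/measurable_EFinP; apply: measurable_funX.
- by move=> w _; rewrite lee_fin sqr_ge0.
rewrite ge0_integralZl_EFin//; last 2 first.
- by apply/measurable_EFinP.
- exact: sqr_ge0.
rewrite ge0_integralZl_EFin//; last 3 first.
- by move=> w _; rewrite lee_fin.
- by apply/measurable_EFinP.
- lra.
rewrite integral_indic// setIT ES integral_cst//= probability_setT mule1.
move=> /le_trans /(_ (leeD2r _ (second_moment_sample_sum mg g01 gmu))).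
rewrite -/c; have : Pr (~` B) \is a fin_num by exact: fin_num_measure.
move=> /fineK <-; rewrite -!EFinM -!EFinD !lee_fin => H.
have c2 : 0 < (c / 2) ^+ 2 by rewrite exprn_gt0//; lra.
rewrite -(ler_pM2l c2).
have : c * 8 <= c * c by rewrite ler_wpM2l//; lra.
by rewrite !expr2 in H *; lra.
Qed.

Lemma ghost_sample (A : set Omega) (B : set (Omega * Omega)) :
  measurable A -> measurable B ->
  (forall w, A w -> ((1 / 2)%:E <= Pr (xsection B w))%E) ->
  (Pr A <= 2%:E * (Pr \x Pr) B)%E.
Proof.
move=> mA mB AB.
have : (\int[Pr]_w ((1 / 2)%:E * (\1_A w)%:E) <= \int[Pr]_w Pr (xsection B w))%E.
  apply: ge0_le_integral => //.
  - by apply/measurable_EFinP; apply: measurable_funM.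
  - exact: measurable_fun_xsection.
  - move=> w _; rewrite indicE; have [wA|wA] := boolP (w \in A).
      by rewrite mule1 AB//; rewrite inE in wA.
    by rewrite mule0.
rewrite ge0_integralZl_EFin//; last exact/measurable_EFinP.
rewrite integral_indic// setIT => H.
rewrite -[leLHS]mul1e (_ : 1%E = 2%:E * (1 / 2)%:E)%E; last by rewrite -EFinM; congr EFin; field.
by rewrite -muleA lee_pmul2l.
Qed.

End Sample.

(** * Invariance of the sample pairs under swaps *)

Section SwapMeasure.
Context (d d' : measure_display) (R : realType) (S : measurableType d)
  (Omega : measurableType d') (Pr : probability Omega R) (P : probability S R)
  (n : nat) (X : 'I_n -> Omega -> S).
Hypothesis mX : forall i, measurable_fun setT (X i).
Hypothesis distX : forall i, has_distribution Pr P (X i).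
Hypothesis indX : mutually_independent Pr X.
Local Notation Z := (n.-tuple (S * S)%type).

Definition swap_pairs (s : {ffun 'I_n -> bool}) (z : Z) : Z :=
  [tuple (if s i then ((tnth z i).2, (tnth z i).1) else tnth z i) | i < n].

Definition sample_pairs (w : Omega * Omega) : Z :=
  [tuple (X i w.1, X i w.2) | i < n].

Definition rectangles : set (set Z) :=
  [set A | exists U V : 'I_n -> set S, [/\ forall i, measurable (U i),
    forall i, measurable (V i) &
    A = [set z | forall i, U i (tnth z i).1 /\ V i (tnth z i).2]]].

(** Preimages under a single coordinate are rectangles with all other sides full, so the coordinates
    are measurable for the generated sigma-algebra. *)
Lemma rectangles_generate (A : set Z) : measurable A -> <<s rectangles >> A.
Proof.
pose T := g_sigma_algebraType rectangles.
have mid : measurable_fun [set: T] (fun z : T => z : Z).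
  apply/measurable_fun_tnthP => i; apply/measurable_fun_pairP; split.
    move=> _ Y mY; rewrite setTI; apply: sub_sigma_algebra.
    exists (fun k => if k == i then Y else setT), (fun=> setT).
    split=> [k|//|]; first by case: ifP.
    apply/seteqP; split => z /=; last by move=> /(_ i); rewrite eqxx => -[].
    by move=> Yz k; split => //; case: eqP => // ->.
  move=> _ Y mY; rewrite setTI; apply: sub_sigma_algebra.
  exists (fun=> setT), (fun k => if k == i then Y else setT).
  split=> [//|k|]; first by case: ifP.
  apply/seteqP; split => z /=; last by move=> /(_ i); rewrite eqxx => -[].
  by move=> Yz k; split => //; case: eqP => // ->.
by move=> mA; have := mid measurableT A mA; rewrite setTI.
Qed.

Lemma measurable_sample_pairs : measurable_fun setT sample_pairs.
Proof.
apply/measurable_fun_tnthP => i; apply/measurable_fun_pairP; split.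
  rewrite (_ : _ \o _ = X i \o fst); first exact: measurableT_comp.
  by apply/funext => w; rewrite /= tnth_mktuple.
rewrite (_ : _ \o _ = X i \o snd); first exact: measurableT_comp.
by apply/funext => w; rewrite /= tnth_mktuple.
Qed.

Lemma measurable_swap_pairs s : measurable_fun setT (swap_pairs s).
Proof.
apply/measurable_fun_tnthP => i; apply/measurable_fun_pairP.
have mt := measurable_tnth i (T := (S * S)%type).
split; case si : (s i).
- rewrite (_ : _ \o _ = snd \o (fun z : Z => tnth z i)); first exact: measurableT_comp.
  by apply/funext => w; rewrite /= tnth_mktuple si.
- rewrite (_ : _ \o _ = fst \o (fun z : Z => tnth z i)); first exact: measurableT_comp.
  by apply/funext => w; rewrite /= tnth_mktuple si.
- rewrite (_ : _ \o _ = fst \o (fun z : Z => tnth z i)); first exact: measurableT_comp.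
  by apply/funext => w; rewrite /= tnth_mktuple si.
- rewrite (_ : _ \o _ = snd \o (fun z : Z => tnth z i)); first exact: measurableT_comp.
  by apply/funext => w; rewrite /= tnth_mktuple si.
Qed.

Lemma sample_box (U : 'I_n -> set S) : (forall i, measurable (U i)) ->
  Pr [set w | forall i, U i (X i w)] = (\prod_i P (U i))%E.
Proof.
by move=> mU; rewrite indX//; apply: eq_bigr => i _; rewrite distX.
Qed.

Lemma measurable_sample_box (U : 'I_n -> set S) : (forall i, measurable (U i)) ->
  measurable [set w | forall i, U i (X i w)].
Proof.
move=> mU; rewrite (_ : [set _ | _] = \bigcap_(i in [set: 'I_n]) (X i @^-1` U i)); last first.
  by apply/seteqP; split => w /= H i; [move=> _; exact: H|exact: H].
apply: fin_bigcap_measurable => // i _.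
by rewrite -[X in measurable X]setTI; apply: mX.
Qed.

Lemma swap_rectangle s (U V : 'I_n -> set S) :
  (forall i, measurable (U i)) -> (forall i, measurable (V i)) ->
  ((Pr \x Pr) ((swap_pairs s \o sample_pairs) @^-1`
    [set z | forall i, U i (tnth z i).1 /\ V i (tnth z i).2]) =
  \prod_i (P (U i) * P (V i)))%E.
Proof.
move=> mU mV.
pose U' i := if s i then V i else U i.
pose V' i := if s i then U i else V i.
have mU' i : measurable (U' i) by rewrite /U'; case: ifP.
have mV' i : measurable (V' i) by rewrite /V'; case: ifP.
rewrite (_ : _ @^-1` _ = [set w | forall i, U' i (X i w)] `*` [set w | forall i, V' i (X i w)]); last first.
  apply/seteqP; split => -[w w'] /=.
    move=> H; split => i; have := H i; rewrite /= !tnth_mktuple /U' /V';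
    by case: ifP => _ /= [].
  move=> [H H'] i; have := H i; have := H' i; rewrite /= !tnth_mktuple /U' /V'.
  by case: ifP.
transitivity (Pr [set w | forall i, U' i (X i w)] * Pr [set w | forall i, V' i (X i w)])%E.
  by apply: product_measure1E; exact: measurable_sample_box.
rewrite !sample_box// -big_split/=; apply: eq_bigr => i _.
by rewrite /U' /V'; case: ifP => // _; rewrite muleC.
Qed.

(** Two finite measures that agree on a generating class stable under intersection coincide; on
    rectangles a swap merely permutes the factors of [swap_rectangle]. *)
Lemma swap_invariant s (E : set Z) : measurable E ->
  ((Pr \x Pr) ((swap_pairs s \o sample_pairs) @^-1` E) = (Pr \x Pr) (sample_pairs @^-1` E))%E.
Proof.
move=> mE.
have m1 : measurable_fun setT (swap_pairs s \o sample_pairs).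
  by apply: measurableT_comp; [exact: measurable_swap_pairs|exact: measurable_sample_pairs].
(* The trivial swap lets [swap_rectangle] compute both sides. *)
pose s0 : {ffun 'I_n -> bool} := [ffun=> false].
have s0E : swap_pairs s0 \o sample_pairs = sample_pairs.
  apply/funext => w /=; apply: eq_from_tnth => i.
  by rewrite tnth_mktuple ffunE.
pose f1 : {mfun (Omega * Omega)%type >-> Z} := HB.pack (swap_pairs s \o sample_pairs) (isMeasurableFun.Build _ _ _ _ _ m1).
pose f2 : {mfun (Omega * Omega)%type >-> Z} := HB.pack sample_pairs (isMeasurableFun.Build _ _ _ _ _ measurable_sample_pairs).
have := @g_sigma_algebra_measure_unique _ R Z rectangles _ (fun=> setT) _ _
  (distribution (Pr \x Pr)%E f1) (distribution (Pr \x Pr)%E f2) _ _ _ E.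
apply.
- move=> _ [U [V [mU mV ->]]].
  rewrite (_ : [set _ | _] = \bigcap_(i in [set: 'I_n]) ((fun z : Z => tnth z i) @^-1` (U i `*` V i))); last first.
    by apply/seteqP; split => w /= H i; [move=> _; exact: H|exact: H].
  apply: fin_bigcap_measurable => // i _.
  rewrite -[X in measurable X]setTI; apply: measurable_tnth => //.
  exact: measurableX.
- move=> _; exists (fun=> setT), (fun=> setT); split => //.
  by apply/seteqP; split.
- by apply/seteqP; split => // z _; exists 0%N.
- move=> _ _ [U [V [mU mV ->]]] [U' [V' [mU' mV' ->]]].
  exists (fun i => U i `&` U' i), (fun i => V i `&` V' i); split.
  + by move=> i; exact: measurableI.
  + by move=> i; exact: measurableI.
  + apply/seteqP; split => z /=.
      by move=> [H H'] i; have [? ?] := H i; have [? ?] := H' i.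
    by move=> H; split => i; have [[? ?] [? ?]] := H i.
- move=> _ [U [V [mU mV ->]]]; rewrite /distribution /pushforward /=.
  rewrite -[in RHS]s0E.
  by rewrite !swap_rectangle.
- by move=> _; rewrite -ge0_fin_numE// fin_num_measure.
- exact: rectangles_generate.
Qed.

(** By invariance the probability equals its average over all swaps; exchanging that average with
    the integral leaves the bound [q] at each fixed [z]. *)
Lemma swap_average (E : set Z) (q : R) : measurable E ->
  (forall z, cprob R (fun s => E (swap_pairs s z)) <= q) ->
  ((Pr \x Pr) (sample_pairs @^-1` E) <= q%:E)%E.
Proof.
move=> mE Eq.
pose B s := (swap_pairs s \o sample_pairs) @^-1` E.
have mB s : measurable (B s).
  by rewrite -[B s]setTI; apply: (measurableT_comp (measurable_swap_pairs s) measurable_sample_pairs).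
have H : (\sum_(s <- enum {: {ffun 'I_n -> bool}}) (Pr \x Pr) (B s) <= (2 ^+ n * q)%:E)%E.
  under eq_bigr do rewrite -[B _]setIT -integral_indic//.
  rewrite -ge0_integral_sum//; last by move=> s; exact/measurable_EFinP.
  apply: (@le_trans _ _ (\int[(Pr \x Pr)%E]_w (2 ^+ n * q)%:E)%E); last first.
    by rewrite integral_cst//= probability_setT mule1.
  apply: ge0_le_integral => //.
  - by move=> w _; apply: sume_ge0 => s _; rewrite lee_fin.
  - by apply: emeasurable_sum => s; exact/measurable_EFinP.
  - move=> w _; rewrite sumEFin lee_fin big_enum/= mulrC.
    rewrite -ler_pdivrMr ?exprn_gt0// mulrC; apply: le_trans (Eq (sample_pairs w)).
    apply: ler_wpM2l; first by rewrite invr_ge0 exprn_ge0.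
    apply: ler_sum => s _; rewrite indicE; case: asboolP => [_|nE].
      by rewrite lern1 leq_b1.
    by rewrite memNset.
have mp := @measurable_sample_pairs.
have mSE : measurable (sample_pairs @^-1` E) by rewrite -[X in measurable X]setTI; apply: mp.
move: H; under eq_bigr do rewrite /B swap_invariant//.
have : (Pr \x Pr)%E (sample_pairs @^-1` E) \is a fin_num.
  exact: (@fin_num_measure _ _ _ ((Pr \x Pr)%E : probability _ R) _ mSE).
move=> /fineK <-; rewrite sumEFin !lee_fin big_enum/= sumr_const.
rewrite card_ffun card_bool card_ord -[X in X <= _]mulr_natl natrX.
by rewrite ler_pM2l// exprn_gt0.
Qed.

End SwapMeasure.

(** * The bad event at a fixed scale *)

Section UnitMean.
Context (d : measure_display) (R : realType) (S : measurableType d) (P : probability S R).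

Lemma integral_unit (g : S -> R) : measurable_fun setT g ->
  (forall s, 0 <= g s <= 1) ->
  exists2 mu, 0 <= mu <= 1 & (\int[P]_s (g s)%:E = mu%:E)%E.
Proof.
move=> mg g01.
have I0 : (0 <= \int[P]_s (g s)%:E)%E.
  by apply: integral_ge0 => s _; rewrite lee_fin; case/andP: (g01 s).
have I1 : (\int[P]_s (g s)%:E <= 1%:E)%E.
  apply: (@le_trans _ _ (\int[P]_s 1%:E)%E); last first.
    by rewrite integral_cst//= probability_setT mule1.
  apply: ge0_le_integral => //.
  - by move=> s _; rewrite lee_fin; case/andP: (g01 s).
  - exact/measurable_EFinP.
  - by move=> s _; rewrite lee_fin; case/andP: (g01 s).
have fI : (\int[P]_s (g s)%:E)%E \is a fin_num.
  by rewrite ge0_fin_numE// (le_lt_trans I1)// ltry.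
exists (fine (\int[P]_s (g s)%:E)%E); last by rewrite fineK.
by rewrite -!lee_fin fineK// I0 I1.
Qed.

(** Along the approximating sequence the empirical means converge, and so do the integrals by
    dominated convergence; a strict inequality in the limit holds at some term. Only countably many
    functions then matter. *)
Lemma class_reduction (n : nat) (x : 'I_n -> S) (F : set (S -> R))
    (G : nat -> S -> R) (f : S -> R) (K b : R) :
  (forall f, F f -> measurable_fun setT f /\ forall s, 0 <= f s <= 1) ->
  (forall m, F (G m)) -> F f ->
  (exists u : nat -> nat, forall s, (fun m => G (u m) s) @ \oo --> f s) ->
  ((K * (emp_mean x f + b))%:E < \int[P]_s (f s)%:E)%E ->
  exists m, ((K * (emp_mean x (G m) + b))%:E < \int[P]_s (G m s)%:E)%E.
Proof.
move=> F01 FG Ff [u uf] Kf.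
have [mf f01] := F01 f Ff.
have [L L01 Lf] := integral_unit mf f01.
have mG m := (F01 _ (FG m)).1; have G01 m := (F01 _ (FG m)).2.
have icvg : (fun m => \int[P]_s (G (u m) s)%:E)%E @ \oo --> (\int[P]_s (f s)%:E)%E.
  have [] // := @dominated_convergence _ _ _ P setT measurableT
    (fun m s => (G (u m) s)%:E) (fun s => (f s)%:E) (cst 1%:E).
  - by move=> m; exact/measurable_EFinP.
  - exact/measurable_EFinP.
  - by apply: aeW => s _; apply: cvg_EFin; [exact: nearW|exact: uf].
  - exact: finite_measure_integrable_cst.
  - apply: aeW => s m _; rewrite /= lee_fin ger0_norm; by case/andP: (G01 (u m) s).
have ecvg : (fun m => K * (emp_mean x (G (u m)) + b)) @ \oo --> K * (emp_mean x f + b).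
  apply: cvgM; first exact: cvg_cst.
  apply: cvgD; last exact: cvg_cst.
  apply: cvgM; first exact: cvg_cst.
  by apply: cvg_big => [|i _]; [exact: add_continuous|exact: uf].
have fcvg : (fun m => fine (\int[P]_s (G (u m) s)%:E)%E) @ \oo --> L.
  by apply: fine_cvg; rewrite -Lf.
have : (fun m => fine (\int[P]_s (G (u m) s)%:E)%E - K * (emp_mean x (G (u m)) + b)) @ \oo -->
   L - K * (emp_mean x f + b) by exact: cvgB.
move: Kf; rewrite Lf lte_fin -subr_gt0 => L0 /cvgr_gt /(_ _ L0)[N _ /(_ N (leqnn N))] /= H.
exists (u N); have [mu _ muE] := integral_unit (mG (u N)) (G01 (u N)).
by rewrite muE lte_fin -subr_gt0; move: H; rewrite muE.
Qed.

End UnitMean.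

(** * Local Rademacher averages of a sequence of functions *)

Section LocalRademacher.
Variables (R : realType) (n : nat) (S : Type).
Local Notation cube := {ffun 'I_n -> bool}.

(* The supremum over [M] under the average is written as one bound per choice
   [phi] of an index for each sign vector. *)
Definition rad_sum_le (g : nat -> S -> R) (M : nat -> Prop) (x : 'I_n -> S) (c : R) :=
  forall phi : cube -> nat, (forall e, M (phi e)) ->
    cavg (fun e : cube => `|\sum_i (-1) ^+ e i * g (phi e) (x i)|) <= c.

Lemma loc_rad_sum_le (F : set (S -> R)) (g : nat -> S -> R) (x : 'I_n -> S) (r c : R) :
  (0 < n)%N -> (forall f, F f -> forall s, 0 <= f s <= 1) -> (forall m, F (g m)) ->
  loc_rad F x r <= c ->
  rad_sum_le g (fun m => \sum_i g m (x i) <= n%:R * r) x (n%:R * c).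
Proof.
move=> n0 F01 Fg Hc phi Mphi.
have n0' : 0 < n%:R :> R by rewrite ltr0n.
have ni0 : 0 <= n%:R^-1 :> R by rewrite invr_ge0 ltW.
apply: le_trans (ler_wpM2l (ltW n0') Hc).
rewrite /loc_rad -/(cavg _) -cavgZ; apply: le_cavg => e.
rewrite -ler_pdivrMl//; apply: ub_le_sup.
  (* Boundedness makes [sup] a genuine upper bound rather than its default value. *)
  exists 1 => _ [f [Ff _] <-].
  rewrite /rad_avg normrM (ger0_norm ni0) ler_pdivrMl// mulr1.
  apply: le_trans (ler_norm_sum _ _ _) _.
  rewrite -[n in n%:R]card_ord -sumr_const; apply: ler_sum => i _.
  rewrite normrM normr_sign mul1r ger0_norm; by case/andP: (F01 f Ff (x i)).
exists (g (phi e)).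
  by split => //; rewrite /emp_mean ler_pdivrMl.
by rewrite /rad_avg normrM (ger0_norm ni0).
Qed.

End LocalRademacher.

(** Since [I] is finite there are countably many choices [phi], so the complement is a countable
    union. *)
Lemma measurable_forall_choice (d : measure_display) (R : realType)
    (T : measurableType d) (I : finType) (h : nat -> T -> R) (k : nat -> I -> T -> R)
    (v a c : R) :
  (forall m, measurable_fun setT (h m)) ->
  (forall m e, measurable_fun setT (k m e)) ->
  measurable [set t | forall phi : I -> nat, (forall e, h (phi e) t <= v) ->
    a * \sum_e k (phi e) e t <= c].
Proof.
move=> mh mk.
have -> : [set t | forall phi : I -> nat, (forall e, h (phi e) t <= v) ->
    a * \sum_e k (phi e) e t <= c] =
  ~` \bigcup_(phi in [set: {ffun I -> nat}])
   ((\bigcap_(e in [set: I]) [set t | h (phi e) t <= v]) `\`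
     [set t | a * \sum_e k (phi e) e t <= c]).
  apply/seteqP; split => t /=.
    move=> H [phi _ [Hh]] /=; apply; apply: (H phi) => e; exact: Hh.
  move=> H phi Hh; apply: contrapT => nH; apply: H.
  exists (finfun phi) => //; split => /=; first by move=> e _ /=; rewrite ffunE.
  by under eq_bigr do rewrite ffunE.
apply: measurableC; apply: countable_bigcupT_measurable; first exact: countableP.
move=> phi; apply: measurableD.
  apply: fin_bigcap_measurable => // e _.
  by rewrite -[X in measurable X]setTI; apply: measurable_fun_le.
rewrite -[X in measurable X]setTI; apply: measurable_fun_le => //.
by apply: measurable_funM => //; apply: measurable_sum.
Qed.

(** * Events for sample pairs and for the sample at one scale *)

Section Scale.
Context (d d' : measure_display) (R : realType) (S : measurableType d)
  (Omega : measurableType d') (Pr : probability Omega R) (P : probability S R)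
  (n : nat) (X : 'I_n -> Omega -> S).
Hypothesis mX : forall i, measurable_fun setT (X i).
Hypothesis distX : forall i, has_distribution Pr P (X i).
Hypothesis indX : mutually_independent Pr X.
Variable g : nat -> S -> R.
Hypothesis mg : forall m, measurable_fun setT (g m).
Hypothesis g01 : forall m s, 0 <= g m s <= 1.
Local Notation Z := (n.-tuple (S * S)%type).

(** The admissible indices are selected by the sum over both halves, which no swap changes. *)
Definition pair_event (v : R) : set Z := [set z |
  (exists2 m, \sum_i (g m (tnth z i).1 + g m (tnth z i).2) <= v &
     v / 16 <= `|\sum_i (g m (tnth z i).1 - g m (tnth z i).2)|) /\
  rad_sum_le g (fun m => \sum_i (g m (tnth z i).1 + g m (tnth z i).2) <= v)
    (fun i => (tnth z i).1) (v / 512)].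

Let mg1 m i : measurable_fun setT (fun z : Z => g m (tnth z i).1).
Proof.
apply: measurableT_comp => //; apply: measurableT_comp => //; exact: measurable_tnth.
Qed.

Let mg2 m i : measurable_fun setT (fun z : Z => g m (tnth z i).2).
Proof.
apply: measurableT_comp => //; apply: measurableT_comp => //; exact: measurable_tnth.
Qed.

Lemma measurable_pair_event v : measurable (pair_event v).
Proof.
apply: measurableI.
  rewrite [X in measurable X](_ : _ = \bigcup_m
    ([set z : Z | \sum_i (g m (tnth z i).1 + g m (tnth z i).2) <= v] `&`
     [set z : Z | v / 16 <= `|\sum_i (g m (tnth z i).1 - g m (tnth z i).2)|])); last first.
    by apply/seteqP; split => z /= [m]; [exists m|move=> _ [? ?]; exists m].
  apply: bigcupT_measurable => m; apply: measurableI.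
    rewrite -[X in measurable X]setTI; apply: measurable_fun_le => //.
    by apply: measurable_sum => i; apply: measurable_funD.
  rewrite -[X in measurable X]setTI; apply: measurable_fun_le => //.
  apply: measurableT_comp => //.
  by apply: measurable_sum => i; apply: measurable_funB.
apply: (@measurable_forall_choice _ _ _ _
  (fun m z => \sum_i (g m (tnth z i).1 + g m (tnth z i).2))
  (fun m (e : {ffun 'I_n -> bool}) z => `|\sum_i (-1) ^+ e i * g m (tnth z i).1|)).
  by move=> m; apply: measurable_sum => i; apply: measurable_funD.
move=> m e; apply: measurableT_comp => //.
by apply: measurable_sum => i; apply: measurable_funM.
Qed.

Lemma pair_event_swap v z : 0 < v ->
  cprob R (fun s => pair_event v (swap_pairs s z)) <= 256 * expR (- (v / 512 ^+ 2 / 9)).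
Proof.
move=> v0.
pose a m i := g m (tnth z i).1; pose b m i := g m (tnth z i).2.
apply: le_trans (@swap_concentration R n nat (fun m => \sum_i (a m i + b m i) <= v)
  a b v v0 (fun m i => g01 m _) (fun m i => g01 m _) (fun m H => H)).
have E1 s m i : g m (tnth (swap_pairs s z) i).1 = swapped a b s m i.
  by rewrite tnth_mktuple /swapped; case: ifP.
have E2 s m i : g m (tnth (swap_pairs s z) i).2 = swapped a b (compl s) m i.
  by rewrite tnth_mktuple /swapped ffunE; case: (s i).
have ME s m : \sum_i (g m (tnth (swap_pairs s z) i).1 + g m (tnth (swap_pairs s z) i).2)
    = \sum_i (a m i + b m i).
  apply: eq_bigr => i _; rewrite tnth_mktuple; case: ifP => _ //=; exact: addrC.
apply: le_cprob => s [[m Mm Hm] Hr]; split.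
  exists m; first by rewrite -(ME s).
  apply: le_trans Hm _; under eq_bigr do rewrite E1 E2.
  exact: lexx.
move=> phi Mphi; have : forall e, \sum_i (g (phi e) (tnth (swap_pairs s z) i).1 +
    g (phi e) (tnth (swap_pairs s z) i).2) <= v by move=> e; rewrite ME.
move=> /Hr; apply: le_trans; apply: le_cavg => e.
by under [X in _ <= `|X|]eq_bigr do rewrite E1.
Qed.

Definition bad_event (sigma : R) : set Omega := [set w |
  (exists2 m, (exists2 mu, sigma < mu <= 2 * sigma & (\int[P]_s (g m s)%:E = mu%:E)%E) &
     \sum_i g m (X i w) <= n%:R * sigma / 8) /\
  rad_sum_le g (fun m => \sum_i g m (X i w) <= 4 * (n%:R * sigma))
    (fun i => X i w) (4 * (n%:R * sigma) / 512)].

Lemma measurable_bad_event sigma : measurable (bad_event sigma).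
Proof.
have mgX m i : measurable_fun setT (fun w => g m (X i w)) by exact: measurableT_comp.
apply: measurableI.
  rewrite [X in measurable X](_ : _ = \bigcup_(m in [set m |
      exists2 mu, sigma < mu <= 2 * sigma & (\int[P]_s (g m s)%:E = mu%:E)%E])
    [set w | \sum_i g m (X i w) <= n%:R * sigma / 8]); last first.
    by apply/seteqP; split => w /= [m Hm Hw]; exists m.
  apply: bigcup_measurable => m _.
  rewrite -[X in measurable X]setTI; apply: measurable_fun_le => //.
  exact: measurable_sum.
apply: (@measurable_forall_choice _ _ _ _
  (fun m w => \sum_i g m (X i w))
  (fun m (e : {ffun 'I_n -> bool}) w => `|\sum_i (-1) ^+ e i * g m (X i w)|)).
  by move=> m; exact: measurable_sum.
move=> m e; apply: measurableT_comp => //.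
by apply: measurable_sum => i; apply: measurable_funM.
Qed.

(** With probability at least [1 / 2] the ghost sum lies between [n * mu / 2] and
    [3 * n * mu / 2 <= 3 * n * sigma], while the sample sum is at most [n * sigma / 8]. The total is
    then below [v = 4 * n * sigma] and the difference above [v / 16]. The ghost sample doubles [256]
    to [512]. *)
Lemma bad_event_prob sigma : 8 <= n%:R * sigma ->
  (Pr (bad_event sigma) <=
    (512 * expR (- (4 * (n%:R * sigma) / 512 ^+ 2 / 9)))%:E)%E.
Proof.
move=> ns8; set v := 4 * (n%:R * sigma).
have v0 : 0 < v by rewrite /v; lra.
have mE : measurable (@sample_pairs _ _ _ _ _ X @^-1` pair_event v).
  rewrite -[X in measurable X]setTI.
  by apply: (measurable_sample_pairs mX) => //; exact: measurable_pair_event.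
apply: le_trans (ghost_sample (measurable_bad_event sigma) mE _) _; last first.
  have := swap_average mX distX indX (measurable_pair_event v)
    (fun z => pair_event_swap z v0).
  move=> /(lee_wpmul2l (_ : (0 <= 2%:E)%E)) => /(_ _)/le_trans; apply; first by [].
  by rewrite -EFinM lee_fin mulrA; apply: ler_wpM2r; rewrite ?expR_ge0//; lra.
move=> w [[m [mu /andP[smu mus] gmu] gw] radw].
have nmu : n%:R * sigma <= n%:R * mu <= 2 * (n%:R * sigma).
  by rewrite mulrCA !ler_wpM2l// ltW.
move: nmu => /andP[nmu1 nmu2].
have c8 : 8 <= n%:R * mu by exact: le_trans nmu1.
apply: le_trans (emp_mean_concentration mX distX indX (mg m) (g01 m) gmu c8) _.
apply: le_measure.
- rewrite inE (_ : mkset _ = [set w | n%:R * mu / 2 <= \sum_i g m (X i w)] `&`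
    [set w | \sum_i g m (X i w) <= 3 * (n%:R * mu / 2)]); last first.
    by apply/seteqP; split => w' /= => [/andP[]|[-> ->]].
  have mgX i : measurable_fun setT (fun w => g m (X i w)) by exact: measurableT_comp.
  apply: measurableI; rewrite -[X in measurable X]setTI; apply: measurable_fun_le => //;
    exact: measurable_sum.
- by rewrite inE; exact: measurable_xsection.
move=> w' /= /andP[]; rewrite /sample_sum => w1 w2; rewrite /xsection /= inE /=.
have T1 i : tnth (@sample_pairs _ _ _ _ _ X (w, w')) i = (X i w, X i w').
  by rewrite tnth_mktuple.
rewrite /pair_event /=.
split.
  exists m.
    under eq_bigr do rewrite T1 /=; rewrite big_split/= /v; lra.
  under eq_bigr do rewrite T1 /=; rewrite sumrB distrC ger0_norm; rewrite /v; lra.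
(* As the functions are nonnegative, a bound on the sum over both halves also bounds the sum over
   the first. *)
move=> phi Mphi; under eq_cavg do under eq_bigr do rewrite T1 /=.
apply: radw => e; apply: le_trans (Mphi e); apply: ler_sum => i _.
by rewrite T1 /= lerDl; case/andP: (g01 (phi e) (X i w')).
Qed.

End Scale.

(** * Peeling over dyadic scales *)

(** From [expR (- (1 / 6)) >= 5 / 6], [e] is at most [(6 / 5) ^+ 6 < 3]. *)
Lemma expR1_le3 (R : realType) : expR 1 <= 3 :> R.
Proof.
set y : R := expR (1 / 6).
have y0 : 0 < y by exact: expR_gt0.
have y65 : y <= 6 / 5.
  have := @expR_ge1Dx R (- (1 / 6)); rewrite expRN -/y => H.
  have : y * (1 - 1 / 6) <= y * y^-1 by rewrite ler_pM2l.
  by rewrite divff ?gt_eqF//; lra.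
have y2 : y * y <= 36 / 25 by nra.
have y3 : y * y * y <= 173 / 100 by nra.
have -> : expR 1 = (y * y * y) * (y * y * y) :> R.
  by rewrite -!expRD; congr expR; field.
have : 0 < y * y * y by rewrite !mulr_gt0.
by nra.
Qed.

Lemma ln_ln_ge0 (R : realType) (n : nat) : (3 <= n)%N -> 0 <= ln (ln n%:R) :> R.
Proof.
move=> n3; have n0 : 0 < n%:R :> R by rewrite ltr0n (leq_trans _ n3).
apply: ln_ge0; rewrite -[leLHS]expRK ler_ln ?posrE ?expR_gt0//.
by apply: le_trans (expR1_le3 R) _; rewrite (ler_nat R 3).
Qed.

(** With [x = expR (- t)] and [12 * 2 ^ k >= 11 + k], each term is at most [512 * x ^+ (11 + k)].
    Ten factors [x <= 1 / 2] absorb [512], [k] more give the geometric decay, and one [x]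
    remains. *)
Lemma geometric_tail (R : realType) (t : R) (n : nat) : expR (- t) <= 1 / 2 ->
  \sum_(k < n) 512 * expR (- (12 * (2 ^+ k * t))) <= 2 * expR (- t).
Proof.
move=> x12; set x := expR (- t) in x12 *.
have x0 : 0 < x by exact: expR_gt0.
have x1 : x <= 1 by lra.
have c0 : 0 < 512 :> R := pos512 R.
have c10 : 512 * (1 / 2) ^+ 10 <= 1 :> R.
  have -> : 512 = 8 ^+ 3 :> R by rewrite -natrX.
  have -> : (1 / 2) ^+ 10 = 1 / 2 * ((1 / 2) ^+ 3) ^+ 3 :> R by ring.
  have -> : (1 / 2) ^+ 3 = 1 / 8 :> R by field.
  by rewrite mulrCA -exprMn (_ : 8 * (1 / 8) = 1) ?expr1n; lra.
move: (512 : R) c0 c10 => c c0 c10.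
suff H : \sum_(k < n) c * expR (- (12 * (2 ^+ k * t))) <= \sum_(k < n) x * (1 / 2) ^+ k.
  apply: le_trans H _; rewrite -mulr_sumr mulrC ler_pM2r//.
  suff -> : \sum_(k < n) (1 / 2) ^+ k = 2 - 2 * (1 / 2) ^+ n :> R.
    by rewrite gerBl mulr_ge0// exprn_ge0.
  elim: n => [|n IH]; first by rewrite big_ord0 expr0; ring.
  by rewrite big_ord_recr/= IH exprS; field.
apply: ler_sum => k _.
have -> : - (12 * (2 ^+ k * t)) = (12 * 2 ^ k)%:R * (- t).
  by rewrite natrM natrX; ring.
rewrite expRM_natl -/x.
apply: (@le_trans _ _ (c * x ^+ (10 + k).+1)).
  rewrite ler_pM2l// ler_wiXn2l ?(ltW x0)//.
  by have := ltn_expl k (isT : (1 < 2)%N); move: (2 ^ k)%N => q; lia.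
rewrite exprS mulrCA ler_pM2l//.
apply: (@le_trans _ _ (c * (1 / 2) ^+ (10 + k))).
  by rewrite ler_pM2l// lerXn2r ?nnegrE// ltW.
by rewrite exprD mulrA ler_piMl// exprn_ge0.
Qed.

Lemma dyadic_scale (R : realType) (s mu : R) (n : nat) : s < mu -> mu <= 2 ^+ n * s ->
  exists2 k, (k < n)%N & 2 ^+ k * s < mu <= 2 * (2 ^+ k * s).
Proof.
move=> smu mun.
have ex : exists j, mu <= 2 ^+ j * s by exists n.
case: (ex_minnP ex) => -[|k]; first by rewrite expr0 mul1r leNgt smu.
move=> muk kmin; exists k; first exact: kmin.
rewrite mulrA -exprS muk andbT ltNge; apply/negP => /kmin.
by rewrite ltnn.
Qed.

(** Each of [K * pn] and [K * rh] is at most [2 * sigma]. The number [128] is [512 / 4], matching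
    the complexity level [4 * n * sigma / 512] of [bad_event]. *)
Lemma scale_bounds (R : realType) (K pn rh b mu sigma : R) :
  16 <= K -> 8 * 128 ^+ 2 <= K -> 0 <= pn -> 0 <= rh -> 0 <= b -> 0 < sigma ->
  K * (pn + (rh + b)) < mu -> mu <= 2 * sigma ->
  [/\ pn <= sigma / 8, rh <= 4 * sigma & 4 * sigma * rh <= (sigma / 128) ^+ 2].
Proof.
move=> K16 K8 pn0 rh0 b0 s0 Kmu mus.
have K0 : 0 < K by apply: lt_le_trans K16.
have Ks := le_trans (ltW Kmu) mus.
have Kpn : K * pn <= 2 * sigma.
  by apply: le_trans Ks; rewrite ler_pM2l// lerDl addr_ge0.
have Krh : K * rh <= 2 * sigma.
  by apply: le_trans Ks; rewrite ler_pM2l// addrCA lerDl addr_ge0.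
have pn16 : 16 * pn <= 2 * sigma by apply: le_trans Kpn; rewrite ler_wpM2r.
have rh16 : 16 * rh <= 2 * sigma by apply: le_trans Krh; rewrite ler_wpM2r.
have rh8 : 8 * 128 ^+ 2 * rh <= 2 * sigma by apply: le_trans Krh; rewrite ler_wpM2r.
split; [lra|lra|].
have H : 4 * 128 ^+ 2 * rh <= sigma.
  by move: rh8; move: (128 ^+ 2 : R) => q; lra.
rewrite expr_div_n ler_pdivlMr ?exprn_gt0// expr2.
have -> : 4 * sigma * rh * 128 ^+ 2 = sigma * (4 * 128 ^+ 2 * rh) by move: (128 ^+ 2 : R) => q; ring.
by rewrite ler_pM2l.
Qed.

(** * From a violated bound to a bad event *)

Section BadEventIntro.
Context (d d' : measure_display) (R : realType) (S : measurableType d)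
  (Omega : measurableType d') (P : probability S R)
  (n : nat) (X : 'I_n -> Omega -> S).
Variables (F : set (S -> R)) (G : nat -> S -> R) (psi : R -> R) (rh K : R) (w : Omega).
Hypothesis n0 : (0 < n)%N.
Hypothesis F01 : forall f, F f -> measurable_fun setT f /\ forall s, 0 <= f s <= 1.
Hypothesis FG : forall m, F (G m).
Hypothesis psi0 : psi 0 = 0.
Hypothesis psi_nd : forall a b, 0 <= a -> a <= b -> psi a <= psi b.
Hypothesis psi_concave : concave_on_nonneg psi.
Hypothesis psi_rad : forall r, 0 <= r -> loc_rad F (fun i => X i w) r <= psi (Num.sqrt r).
Hypothesis rh0 : 0 <= rh.
Hypothesis rhE : rh = psi (Num.sqrt rh).
Hypothesis rhmax : forall r, 0 <= r -> r = psi (Num.sqrt r) -> r <= rh.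
Hypothesis K16 : 16 <= K.
Hypothesis K8 : 8 * 128 ^+ 2 <= K.

(** The complexity at radius [4 * sigma >= rh] is at most [sqrt (4 * sigma * rh) <= sigma / 128], by
    [above_fixed_point] and [scale_bounds]. *)
Lemma bad_event_intro (m : nat) (mu sigma b : R) : 0 <= b ->
  (\int[P]_s (G m s)%:E = mu%:E)%E ->
  K * (emp_mean (fun i => X i w) (G m) + (rh + b)) < mu ->
  0 < sigma -> sigma < mu <= 2 * sigma -> bad_event P X G sigma w.
Proof.
move=> b0 muE Kmu s0 smu; have /andP[_ mus] := smu.
have n0' : 0 < n%:R :> R by rewrite ltr0n.
set pn := emp_mean _ _ in Kmu.
have nz : n%:R != 0 :> R by rewrite gt_eqF.
have pnE : \sum_i G m (X i w) = n%:R * pn by rewrite /pn /emp_mean mulVKf.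
have pn0 : 0 <= pn.
  by rewrite mulr_ge0 ?invr_ge0 ?ler0n// sumr_ge0// => i _; case/andP: ((F01 (FG m)).2 (X i w)).
have [pns rhs rhs2] := scale_bounds K16 K8 pn0 rh0 b0 s0 Kmu mus.
split.
  by exists m; [exists mu|rewrite pnE -mulrA ler_pM2l].
have -> : 4 * (n%:R * sigma) / 512 = n%:R * (sigma / 128) by field.
have -> : 4 * (n%:R * sigma) = n%:R * (4 * sigma) by ring.
apply: (@loc_rad_sum_le R n S F) => //; first by move=> f /F01[].
have s40 : 0 <= 4 * sigma by rewrite mulr_ge0// ltW.
apply: le_trans (psi_rad s40) _.
apply: le_trans (above_fixed_point psi0 psi_nd psi_concave rh0 rhE rhmax rhs) _.
have s128 : 0 <= sigma / 128 by rewrite divr_ge0// ltW.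
by rewrite -[leRHS](ger0_norm s128) -sqrtr_sqr ler_wsqrtr.
Qed.

End BadEventIntro.

Theorem theorem2 (R : realType) :
  exists K : R, 0 < K /\
  forall (d d' : measure_display) (S : measurableType d)
    (Omega : measurableType d') (Pr : probability Omega R)
    (P : probability S R) (n : nat) (X : 'I_n -> Omega -> S)
    (F : set (S -> R)) (psi : ('I_n -> S) -> R -> R) (rhat : ('I_n -> S) -> R),
  (3 <= n)%N ->
  (forall i, measurable_fun setT (X i)) ->
  (forall i, has_distribution Pr P (X i)) ->
  mutually_independent Pr X ->
  (forall f, F f -> measurable_fun setT f /\ forall s, 0 <= f s <= 1) ->
  pointwise_measurable_class F ->
  (forall w, let x := fun i => X i w in
     [/\ psi x 0 = 0,
         (forall s, 0 <= s -> 0 <= psi x s),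
         (forall a b, 0 <= a -> a <= b -> psi x a <= psi x b),
         concave_on_nonneg (psi x) &
         forall r, 0 <= r -> loc_rad F x r <= psi x (Num.sqrt r)]) ->
  (forall w, let x := fun i => X i w in
     [/\ 0 <= rhat x, rhat x = psi x (Num.sqrt (rhat x)) &
         forall r, 0 <= r -> r = psi x (Num.sqrt r) -> r <= rhat x]) ->
  forall t : R, 0 < t ->
  exists A : set Omega, [/\ measurable A,
    A `<=` [set w | forall f, F f ->
       (\int[P]_s (f s)%:E <=
        (K * (emp_mean (fun i => X i w) f + rhat (fun i => X i w)
              + (t + ln (ln n%:R)) / n%:R))%:E)%E] &
    ((1 - 2 * expR (- t))%:E <= Pr A)%E].
Proof.
(* Chosen so that the exponent [4 * (2 ^+ k * (K * t)) / 512 ^+ 2 / 9] equals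
   [12 * (2 ^+ k * t)]. *)
pose K : R := 27 * 512 ^+ 2; exists K.
have K8 : 8 * 128 ^+ 2 <= K.
  have -> : K = 27 * 4 ^+ 2 * 128 ^+ 2.
    by rewrite /K (_ : 512 = 4 * 128) ?exprMn ?mulrA// -natrM.
  by rewrite ler_pM2r ?exprn_gt0// expr2; lra.
have K16 : 16 <= K.
  apply: le_trans K8; have : 128 <= 128 ^+ 2 :> R by rewrite ler_eXnr// ler1n.
  lra.
have K0 : 0 < K by lra.
split=> // d d' S Omega Pr P n X F psi rhat n3 mX distX indX F01 [G [FG GF]] psiH rhatH t t0.
have n0 : (0 < n)%N by exact: leq_trans n3.
have n0' : 0 < n%:R :> R by rewrite ltr0n.
(* For such small [t] the required probability is nonpositive and the empty event suffices.
   Otherwise [t > 1 / 2], so that [K * t >= 8] as Chebyshev's inequality demands. *)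
have [x12|x12] := leP (1 / 2) (expR (- t)).
  by exists set0; split => //; rewrite measure0 lee_fin; lra.
have t12 : 1 / 2 < t by have := @expR_ge1Dx R (- t); lra.
have Kt : 8 <= K * t by apply: (@le_trans _ _ (16 * t)); [lra|rewrite ler_pM2r].
pose sigma k := 2 ^+ k * (K * t / n%:R).
have s0 : 0 < K * t / n%:R by rewrite divr_gt0// mulr_gt0.
have sig0 k : 0 < sigma k by rewrite mulr_gt0// exprn_gt0.
have nsig k : n%:R * sigma k = 2 ^+ k * (K * t).
  by rewrite /sigma; field; rewrite gt_eqF.
have mG m := (F01 _ (FG m)).1; have G01 m := (F01 _ (FG m)).2.
have mBad k : measurable (bad_event P X G (sigma k)) by exact: measurable_bad_event.
(* Scales up to [n] reach every mean: [mu <= 1 <= 2 ^+ n * (K * t / n)], because [n <= 2 ^ n] and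
   [K * t >= 1]. *)
pose Bad := \big[setU/set0]_(k < n) bad_event P X G (sigma k).
have mB : measurable Bad by exact: bigsetU_measurable.
exists (~` Bad); split; first exact: measurableC.
  move=> w nBad f Ff /=; rewrite leNgt; apply/negP => Hf; apply: nBad.
  pose b := (t + ln (ln n%:R)) / n%:R.
  have b0 : t / n%:R <= b by rewrite ler_pM2r ?invr_gt0// lerDl ln_ln_ge0.
  have b00 : 0 <= b by apply: le_trans b0; rewrite divr_ge0 ?ltW.
  rewrite -addrA -/b in Hf.
  have [m Hm] := class_reduction F01 FG Ff (GF f Ff) Hf.
  have [mu /andP[mu0 mu1] muE] := integral_unit P (mG m) (G01 m).
  rewrite muE lte_fin in Hm.
  have [psi0 _ psi_nd psi_conc psi_rad] := psiH w.
  have [rh0 rhE rhmax] := rhatH w.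
  have pn0 : 0 <= emp_mean (fun i => X i w) (G m).
    by rewrite mulr_ge0 ?invr_ge0 ?ler0n// sumr_ge0// => i _; case/andP: (G01 m (X i w)).
  have s0mu : K * t / n%:R < mu.
    apply: le_lt_trans Hm; rewrite -mulrA ler_pM2l//; lra.
  have muS : mu <= 2 ^+ n * (K * t / n%:R).
    apply: le_trans mu1 _; rewrite mulrA ler_pdivlMr// mul1r.
    apply: (@le_trans _ _ (2 ^+ n * 1)); last by rewrite ler_pM2l ?exprn_gt0//; lra.
    by rewrite mulr1 -natrX ler_nat ltnW// ltn_expl.
  have [k kn smu] := dyadic_scale s0mu muS.
  rewrite /Bad -(big_mkord xpredT (fun k => bad_event P X G (sigma k))).
  rewrite -bigcup_seq; exists k; first by rewrite /= mem_index_iota.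
  exact: (bad_event_intro n0 F01 FG psi0 psi_nd psi_conc psi_rad rh0 rhE rhmax K16 K8 b00 muE Hm (sig0 k) smu).
have PBad : (Pr Bad <= (2 * expR (- t))%:E)%E.
  have := @Boole_inequality _ _ _ Pr (fun k => bad_event P X G (sigma k)) n (fun k _ => mBad k).
  move=> /le_trans; apply.
  apply: (@le_trans _ _ (\sum_(k < n) (512 * expR (- (12 * (2 ^+ k * t))))%:E)%E).
    apply: lee_sum => k _.
    have n8 : 8 <= n%:R * sigma k.
      rewrite nsig; apply: (le_trans Kt); rewrite ler_peMl ?exprn_ege1 ?ler1n//.
      exact: le_trans Kt.
    apply: le_trans (bad_event_prob mX distX indX mG G01 n8) _.
    rewrite nsig lee_fin (_ : _ / 9 = 12 * (2 ^+ k * t))// /K.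
    have : 512 ^+ 2 != 0 :> R := expf_neq0 2 (lt0r_neq0 (pos512 R)).
    by move: (512 ^+ 2 : R) => q q0; field.
  by rewrite sumEFin lee_fin geometric_tail// ltW.
rewrite probability_setC//.
have : Pr Bad \is a fin_num by exact: fin_num_measure.
by move=> /fineK PB; move: PBad; rewrite -PB -EFinB !lee_fin; lra.
Qed.
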